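(* For any $s\in(\frac12,1)$, there exists a solution $u\in L_s(\mathbb{R})$ of $$(-\Delta)^s u = e^u \ \text{ in } \mathbb{R} \quad\text{with}\quad \int_{\mathbb{R}} e^u\,dx < +\infty .$$
   Context: For $s\in(0,1)$ and $\varphi\in C_c^\infty(\mathbb{R})$, $(-\Delta)^s\varphi(x) = C_s\,\mathrm{PV}\int_{\mathbb{R}}\frac{\varphi(x)-\varphi(y)}{|x-y|^{1+2s}}\,dy$ with $C_s = \frac{4^s}{\sqrt{\pi}}\frac{\Gamma(\frac12+s)}{|\Gamma(-s)|}$. The space $L_s(\mathbb{R})$ consists of all real-valued $u\in L^1_{\mathrm{loc}}(\mathbb{R})$ with $\int_{\mathbb{R}}\frac{|u(x)|}{1+|x|^{1+2s}}\,dx<+\infty$. A function $u\in L_s(\mathbb{R})$ with $e^u\in L^1_{\mathrm{loc}}(\mathbb{R})$ is a solution of $(-\Delta)^s u = e^u$ if $\int_{\mathbb{R}} u\,(-\Delta)^s\varphi\,dx = \int_{\mathbb{R}} e^u\varphi\,dx$ for all $\varphi\in C_c^\infty(\mathbb{R})$. *)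

(* Defs.v *)
From HB Require Import structures.
From mathcomp Require Import all_boot all_order all_algebra.
From mathcomp Require Import all_classical all_reals all_analysis.

Set Implicit Arguments.
Unset Strict Implicit.
Unset Printing Implicit Defensive.

Import Order.TTheory GRing.Theory Num.Theory.
Import numFieldNormedType.Exports.

Local Open Scope classical_set_scope.
Local Open Scope ring_scope.

(* Euler's integral; it is the Gamma function only for [0 < x]. *)
Definition euler_gamma (R : realType) (x : R) : R :=
  Rintegral (@lebesgue_measure R) [set t : R | 0 < t]
    (fun t => t `^ (x - 1) * expR (- t)).

(* The Gamma function on the reals, extended from the positive half-line by
   Gamma (x + 1) = x * Gamma x. For [x <= 0] the natural number
   [n = (Num.truncn (- x)).+1] is the least one with [0 < x + n]. At the poles
   0, -1, -2, ... the value is 0, because division by 0 gives 0. *)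
Definition Gamma (R : realType) (x : R) : R :=
  let n := if 0 < x then 0%N else (Num.truncn (- x)).+1 in
  euler_gamma (x + n%:R) / \prod_(k < n) (x + k%:R).

Definition test_function (R : realType) (phi : R -> R) : Prop :=
  (forall (n : nat) (x : R), derivable (derive1n n phi) x 1) /\
  compact (closure [set x : R | phi x != 0]).

Definition frac_laplacian_cst (R : realType) (s : R) : R :=
  4 `^ s / Num.sqrt pi * (Gamma (2^-1 + s) / `|Gamma (- s)|).

(* The principal value is the limit, as eps decreases to 0, of the integrals over
   the complement of the interval of radius eps around x. For a test function
   and 0 < s < 1 these integrals converge absolutely and the limit exists, so
   the default values of [Rintegral] and [lim] are not used. *)
Definition frac_laplacian (R : realType) (s : R) (phi : R -> R) (x : R) : R :=
  frac_laplacian_cst s *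
  lim (Rintegral (@lebesgue_measure R) [set y : R | eps < `|x - y|]
         (fun y => (phi x - phi y) / `|x - y| `^ (1 + 2 * s))
       @[eps --> (0 : R)^'+]).

(* [locally_integrable] includes (Borel) measurability, so an element is a Borel
   representative of a class of almost everywhere equal functions. *)
Definition L_space (R : realType) (s : R) (u : R -> R) : Prop :=
  locally_integrable [set: R] u /\
  (\int[@lebesgue_measure R]_(x in [set: R])
      (`|u x| / (1 + `|x| `^ (1 + 2 * s)))%:E < +oo)%E.

(* For [u] in [L_space s] both integrands are integrable, since
   [frac_laplacian s phi] is continuous and O(|x|^-(1 + 2 s)) at infinity. *)
Definition liouville_solution (R : realType) (s : R) (u : R -> R) : Prop :=
  [/\ L_space s u,
      locally_integrable [set: R] (fun x => expR (u x)) &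
      forall phi : R -> R, test_function phi ->
        (\int[@lebesgue_measure R]_(x in [set: R])
           (u x * frac_laplacian s phi x)%:E =
         \int[@lebesgue_measure R]_(x in [set: R])
           (expR (u x) * phi x)%:E)%E].

(* Main.v *)
Require Import Defs.
From HB Require Import structures.
From mathcomp Require Import all_boot all_order all_algebra.
From mathcomp Require Import all_classical all_reals all_analysis.
From mathcomp Require Import measurable_realfun ring lra.

(** Put [a = 2 s - 1], which lies in (0, 1). Since [(-Delta)^s |x - y|^a] is a
    negative multiple of the Dirac mass at [y], it suffices to find [v] with
    [v x = - lam \int |x - y|^a e^(v y) dy - K] for the right [lam > 0]: such a [v]
    behaves like [- lam |x|^a] at infinity.

    The normalised equation is solved by iterating the mean-field map
    [v |-> - lam |.|^a * e^v - ln Z]. The kernel [|x - y|^a] is of negative type, being a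
    superposition of [1 - cos (t (x - y))], so the interaction energy is concave and one
    step decreases the free energy [\int v e^v + lam / 2 \int\int |x - y|^a e^v e^v] by at
    least the relative entropy of [e^v] with respect to its image. For even densities the
    free energy controls the moment [\int |x|^a e^v], hence the iterates are equi-Hoelder
    and within bounded distance of [- lam |x|^a]. A subsequence converges pointwise, and
    the relative entropy between its limit and the image of that limit is zero.

    For the fundamental solution, Fubini and two translations move the second difference
    from the test function onto [|x - y|^a]; one integration by parts in [x] then leaves
    second differences of [z |z|^a], whose integral against [h^-(2 + a)] is a multiple of
    [sgn z] by scaling, with a negative factor because their sign is constant. *)

(** The hypothesis s > 1/2 enters as a > 0: the kernel then grows, the term [- lam |x|^a] confines,
    and [e^v] is integrable. The additive constant K is invisible to the equation, because the
    fractional Laplacian of a test function has integral zero. Hence the density can be normalised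
    to mass 1, and lam is dictated by the constants of the fundamental solution. This lam need not
    be small, so no contraction argument is available; the iteration only uses that the entropy gaps
    are summable.

    Evenness is essential for compactness: the free energy is invariant under translations, so
    without a symmetry it could not control a moment about the origin.

    The integration by parts answers a divergence: the second difference of [|z|^a] at z = 0 is of
    order h^a, and against h^-(2 + a) this leaves the non-integrable h^-2. The primitive
    [z |z|^a / (1 + a)] is smoother by one derivative and odd, and the Dirac mass comes back as half
    the derivative of sgn. *)

Set Implicit Arguments.
Unset Strict Implicit.
Unset Printing Implicit Defensive.

Import Order.TTheory GRing.Theory Num.Theory.
Import numFieldNormedType.Exports.

Local Open Scope classical_set_scope.
Local Open Scope ring_scope.

(** * Integration of real functions *)

(* Locked, because unification otherwise unfolds integrals down to suprema of
   simple functions. *)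
HB.lock Definition Rint d (T : measurableType d) (R : realType)
  (m : {measure set T -> \bar R}) (f : T -> R) : R := Rintegral m setT f.
Canonical Rint_unlockable := Unlockable Rint.unlock.

Notation "\Rint [ m ]_ x f" := (Rint m (fun x => f)%R)
  (at level 36, m at level 10, x at level 1, f at level 36,
   format "'[' \Rint [ m ]_ x '/  '  f ']'") : ring_scope.

Lemma RintE d (T : measurableType d) (R : realType)
    (m : {measure set T -> \bar R}) (f : T -> R) :
  Rint m f = fine (\int[m]_x (f x)%:E)%E.
Proof. by rewrite unlock. Qed.

Section measurability.
Context d (T : measurableType d) (R : realType).
Implicit Types (f g h : T -> R) (k : R).

Lemma measurable_fun_opp f : measurable_fun setT f -> measurable_fun setT (fun x => - f x).
Proof. exact: measurableT_comp. Qed.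

Lemma measurable_fun_norm f : measurable_fun setT f -> measurable_fun setT (fun x => `|f x|).
Proof. by move=> mf; apply: measurableT_comp. Qed.

Lemma measurable_fun_powR f (p : R) : measurable_fun setT f -> measurable_fun setT (fun x => f x `^ p).
Proof. by move=> mf; exact: (measurableT_comp (measurable_powR p) mf). Qed.

Lemma measurable_fun_expR f : measurable_fun setT f -> measurable_fun setT (fun x => expR (f x)).
Proof. by move=> mf; exact: (measurableT_comp (@measurable_expR R) mf). Qed.

Lemma measurable_fun_comp_continuous f (g : R -> R) : continuous g ->
  measurable_fun setT f -> measurable_fun setT (fun x => g (f x)).
Proof. by move=> cg mf; exact: (measurableT_comp (continuous_measurable_fun cg) mf). Qed.

End measurability.

Ltac meas := repeat first
  [ assumption | exact: measurable_id | exact: measurable_cst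
  | exact: measurable_fst | exact: measurable_snd
  | apply: measurable_funD | apply: measurable_funB | apply: measurable_funM
  | apply: measurable_fun_opp | apply: measurable_fun_norm
  | apply: measurable_fun_powR | apply: measurable_fun_expR
  | apply: (measurable_fun_comp_continuous (@continuous_cos _))
  | apply: (measurable_fun_comp_continuous (@continuous_sin _)) ].

Section integrable_real_functions.
Context d (T : measurableType d) (R : realType).
Variable m : {measure set T -> \bar R}.
Implicit Types (f g h : T -> R) (k : R).

(* A wrapper type, so that unification never compares the integrability predicate
   with other boolean propositions by unfolding. *)
Variant intble f : Prop := Intble of m.-integrable setT (EFin \o f).

Lemma intbleP f : intble f -> m.-integrable setT (EFin \o f).
Proof. by case. Qed.

Lemma intble_measurable f : intble f -> measurable_fun setT f.
Proof. by move=> /intbleP /measurable_int /measurable_EFinP. Qed.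

Lemma le_intble f g : measurable_fun setT f -> (forall x, `|f x| <= g x) ->
  intble g -> intble f.
Proof.
move=> mf fg [g1]; split; apply: le_integrable g1 => //; first exact/measurable_EFinP.
by move=> x _ /=; rewrite lee_fin (le_trans (fg x))// ler_norm.
Qed.

Lemma intbleD f g : intble f -> intble g -> intble (fun x => f x + g x).
Proof. by move=> [f1] [g1]; split; have := integrableD measurableT f1 g1. Qed.

Lemma intbleN f : intble f -> intble (fun x => - f x).
Proof. by move=> [f1]; split; have := integrableN f1. Qed.

Lemma intbleB f g : intble f -> intble g -> intble (fun x => f x - g x).
Proof. by move=> f1 g1; exact/intbleD/intbleN. Qed.

Lemma intbleZl k f : intble f -> intble (fun x => k * f x).
Proof. by move=> [f1]; split; have := integrableZl measurableT k f1. Qed.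

Lemma intbleZr k f : intble f -> intble (fun x => f x * k).
Proof. by move=> [f1]; split; have := integrableZr measurableT k f1. Qed.

Lemma intble_norm f : intble f -> intble (fun x => `|f x|).
Proof. by move=> [f1]; split; have := integrable_abse f1. Qed.

Lemma intble0 : intble (fun=> 0).
Proof. split; exact: integrable0. Qed.

Lemma intbleMl h f k : measurable_fun setT h -> (forall x, `|h x| <= k) ->
  intble f -> intble (fun x => h x * f x).
Proof.
move=> mh hk f1; apply: (@le_intble _ (fun x => k * `|f x|)).
- by apply: measurable_funM => //; exact: intble_measurable.
- by move=> x; rewrite normrM ler_wpM2r.
- exact/intbleZl/intble_norm.
Qed.

Lemma intbleE f : intble f -> (\int[m]_x (f x)%:E)%E = (\Rint[m]_x f x)%:E.
Proof. by move=> [f1]; rewrite RintE fineK//; exact: integrable_fin_num. Qed.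

Lemma intble_lty f : intble f -> (\int[m]_x (f x)%:E < +oo)%E.
Proof. by move=> /intbleE ->; rewrite ltry. Qed.

Lemma RintD f g : intble f -> intble g ->
  \Rint[m]_x (f x + g x) = \Rint[m]_x f x + \Rint[m]_x g x.
Proof. by move=> [f1] [g1]; rewrite unlock; exact: RintegralD. Qed.

Lemma RintB f g : intble f -> intble g ->
  \Rint[m]_x (f x - g x) = \Rint[m]_x f x - \Rint[m]_x g x.
Proof. by move=> [f1] [g1]; rewrite unlock; exact: RintegralB. Qed.

Lemma RintZl k f : intble f -> \Rint[m]_x (k * f x) = k * \Rint[m]_x f x.
Proof. by move=> [f1]; rewrite unlock; exact: RintegralZl. Qed.

Lemma RintZr k f : intble f -> \Rint[m]_x (f x * k) = \Rint[m]_x f x * k.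
Proof. by move=> [f1]; rewrite unlock; exact: RintegralZr. Qed.

Lemma eq_Rint f g : f =1 g -> \Rint[m]_x f x = \Rint[m]_x g x.
Proof. by move=> /funext ->. Qed.

Lemma RintN f : intble f -> \Rint[m]_x (- f x) = - \Rint[m]_x f x.
Proof.
by move=> f1; rewrite -mulN1r -RintZl//; apply: eq_Rint => x; rewrite mulN1r.
Qed.

Lemma Rint_ge0 f : (forall x, 0 <= f x) -> 0 <= \Rint[m]_x f x.
Proof. by move=> f0; rewrite unlock; apply: Rintegral_ge0. Qed.

Lemma le_Rint f g : intble f -> intble g -> (forall x, f x <= g x) ->
  \Rint[m]_x f x <= \Rint[m]_x g x.
Proof. by move=> [f1] [g1] fg; rewrite unlock; apply: le_Rintegral. Qed.

Lemma ler_norm_Rint f g : intble f -> intble g -> (forall x, `|f x| <= g x) ->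
  `|\Rint[m]_x f x| <= \Rint[m]_x g x.
Proof.
move=> f1 g1 fg; apply: (@le_trans _ _ (\Rint[m]_x `|f x|)).
  by rewrite unlock; exact: (le_normr_Rintegral measurableT (intbleP f1)).
by apply: le_Rint => //; exact: intble_norm.
Qed.

Lemma eq_intble f g : f =1 g -> intble f -> intble g.
Proof. by move=> /funext ->. Qed.

Lemma Rint_eq0_ae f : intble f -> (forall x, 0 <= f x) -> \Rint[m]_x f x = 0 ->
  {ae m, forall x, f x = 0}.
Proof.
move=> f1 f0 I0; have mf : measurable_fun setT (EFin \o f) by apply/measurable_EFinP; exact: intble_measurable.
have : (\int[m]_x `|(EFin \o f) x| = 0)%E.
  under eq_integral do rewrite /= ger0_norm//.
  by rewrite intbleE// I0.
move=> /(ae_eq_integral_abs _ measurableT mf).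
by apply: filterS => x /(_ I) [].
Qed.

Lemma ae_eq_Rint f g : measurable_fun setT f -> measurable_fun setT g ->
  {ae m, forall x, f x = g x} -> \Rint[m]_x f x = \Rint[m]_x g x.
Proof.
move=> mf mg fg; rewrite !RintE; congr fine.
apply: ae_eq_integral => //; [exact/measurable_EFinP..|].
by apply: filterS fg => x -> .
Qed.

Lemma intble_dominated (f_ : nat -> T -> R) f g :
  (forall n, measurable_fun setT (f_ n)) -> intble g ->
  (forall n x, `|f_ n x| <= g x) -> (forall x, f_ n x @[n --> \oo] --> f x) ->
  intble f.
Proof.
move=> mf g1 fg ff; apply: (@le_intble _ g) => //.
  by apply: (measurable_fun_cvg mf) => x _; exact: ff.
move=> x; apply: (cvgr_to_le (cvg_norm (ff x))).
by near=> n; exact: fg.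
Unshelve. all: by end_near. Qed.

Lemma Rint_dominated_cvg (f_ : nat -> T -> R) f g :
  (forall n, measurable_fun setT (f_ n)) -> intble g ->
  (forall n x, `|f_ n x| <= g x) -> (forall x, f_ n x @[n --> \oo] --> f x) ->
  \Rint[m]_x f_ n x @[n --> \oo] --> \Rint[m]_x f x.
Proof.
move=> mf g1 fg ff; have f1 := intble_dominated mf g1 fg ff.
have fn1 n : intble (f_ n) by exact: le_intble (fg n) _.
have [] := @dominated_convergence _ _ _ m setT measurableT
  (fun n => EFin \o f_ n) (EFin \o f) (EFin \o g).
- by move=> n; exact/measurable_EFinP.
- exact/measurable_EFinP/intble_measurable.
- apply/aeW => x _ /=; apply: cvg_EFin; last exact: ff.
  by apply: nearW.
- exact: intbleP g1.
- by apply/aeW => x n _ /=; rewrite lee_fin.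
by move=> _ _; rewrite intbleE// => /fine_cvg/=; rewrite unlock; exact.
Qed.

End integrable_real_functions.

(** * Affine substitutions in Lebesgue integrals *)

Section affine_change_of_variable.
Context (R : realType).
Notation mu := (@lebesgue_measure R).
Variables (b c : R).
Hypothesis b0 : b != 0.

Let phi x : R := b * x + c.

Let mphi : measurable_fun setT phi.
Proof. by rewrite /phi; meas. Qed.

(** Lebesgue measure is determined by the lengths of half-open intervals, so only the preimages of
    []x, y]] have to be measured. For negative [b] the closed endpoint changes side, which does not
    affect the length. *)
Let pushforward_affine (P : {measure set (measurableTypeR R) -> \bar R}) :
  (forall A, P A = pushforward mu (phi : _ -> measurableTypeR R) A) ->
  forall A : set R, measurable A -> mscale (NngNum (normr_ge0 b)) P A = mu A.
Proof.
move=> HP A mA; apply/esym/lebesgue_measure_unique => //= _ [[x y]] _ <-.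
rewrite /mscale/= HP /pushforward lebesgue_measure_itv/= lte_fin.
have [b_gt0|b_le0] := ltP 0 b.
- rewrite (_ : _ @^-1` _ = `](x - c) / b, (y - c) / b]%classic); last first.
    apply/seteqP; split => z /=; rewrite /phi !in_itv/= ltr_pdivrMr// ler_pdivlMr//;
    by move=> /andP[? ?]; apply/andP; split; lra.
  rewrite lebesgue_measure_itv/= lte_fin ltr_pM2r ?invr_gt0// ltrD2r.
  case: ifPn => xy; last by rewrite mule0.
  by rewrite -!EFinD -EFinM gtr0_norm//; congr EFin; field.
- have b_lt0 : b < 0 by rewrite lt_neqAle b0.
  rewrite (_ : _ @^-1` _ = `[(y - c) / b, (x - c) / b[%classic); last first.
    apply/seteqP; split => z /=; rewrite /phi !in_itv/= ltr_ndivlMr// ler_ndivrMr//;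
    by move=> /andP[? ?]; apply/andP; split; lra.
  rewrite lebesgue_measure_itv/= lte_fin ltr_nM2r ?invr_lt0// ltrD2r.
  case: ifPn => xy; last by rewrite mule0.
  by rewrite -!EFinD -EFinM ltr0_norm//; congr EFin; field.
Qed.

Lemma ge0_integral_affine (f : R -> \bar R) :
  measurable_fun setT f -> (forall x, 0 <= f x)%E ->
  (\int[mu]_x f (b * x + c)%R = `|b|^-1%:E * \int[mu]_x f x)%E.
Proof.
move=> mf f0.
suff H (P : {measure set (measurableTypeR R) -> \bar R}) :
    (forall A, P A = pushforward mu (phi : _ -> measurableTypeR R) A) ->
    (\int[mu]_x f x = `|b|%:E * \int[mu]_x f (phi x))%E.
  rewrite (H _ (fun=> erefl))// muleA -EFinM mulVf ?normr_eq0// mul1e.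
  by rewrite /phi.
move=> HP; rewrite [LHS](@eq_measure_integral _ _ _ _ (mscale (NngNum (normr_ge0 b)) P)).
  rewrite ge0_integral_mscale//=; congr (_ * _)%E.
  rewrite (@eq_measure_integral _ _ _ _ (pushforward mu (phi : _ -> measurableTypeR R)))//.
  by rewrite ge0_integral_pushforward.
by move=> A mA _; exact/esym/pushforward_affine.
Qed.

Lemma intble_affine (f : R -> R) : intble mu f -> intble mu (fun x => f (b * x + c)).
Proof.
move=> f1; have mf := intble_measurable f1.
split; apply/integrableP; split.
  by apply/measurable_EFinP; exact: (measurableT_comp mf mphi).
rewrite (@ge0_integral_affine (fun x => `|(f x)%:E|)%E)//; last first.
  by apply: measurableT_comp => //; exact/measurable_EFinP.
by rewrite lte_mul_pinfty ?lee_fin ?invr_ge0//; case/integrableP: (intbleP f1).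
Qed.

(** The nonnegative case carries over through [f = |f| - (|f| - f)]. *)
Lemma Rint_affine (f : R -> R) : intble mu f ->
  \Rint[mu]_x f (b * x + c) = `|b|^-1 * \Rint[mu]_x f x.
Proof.
move=> f1.
have H (g : R -> R) : intble mu g -> (forall x, 0 <= g x) ->
    \Rint[mu]_x g (b * x + c) = `|b|^-1 * \Rint[mu]_x g x.
  move=> g1 g0; apply: EFin_inj; rewrite EFinM -!intbleE//; last exact: intble_affine.
  rewrite (@ge0_integral_affine (EFin \o g))//.
  by apply/measurable_EFinP; exact: intble_measurable g1.
have a1 := intble_norm f1; have d1 := intbleB a1 f1.
have Ha := H _ a1 (fun x => normr_ge0 _).
have Hd : \Rint[mu]_x (`|f (b * x + c)| - f (b * x + c)) =
    `|b|^-1 * \Rint[mu]_x (`|f x| - f x).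
  by apply: (H _ d1) => x; rewrite subr_ge0 ler_norm.
move: Hd; rewrite RintB ?(RintB a1)//.
- by rewrite Ha mulrBr => /addrI /oppr_inj.
- exact: (@intble_affine (fun x => `|f x|)).
- exact: intble_affine.
Qed.

End affine_change_of_variable.

Section translation_reflection_scaling.
Context (R : realType).
Notation mu := (@lebesgue_measure R).
Implicit Types f : R -> R.

Lemma intble_shift f c : intble mu f -> intble mu (fun x => f (x + c)).
Proof.
by move=> /(intble_affine c (oner_neq0 R)); congr (intble _ _); apply/funext => x; rewrite mul1r.
Qed.

Lemma intble_reflect f c : intble mu f -> intble mu (fun x => f (c - x)).
Proof.
have n1 : -1 != 0 :> R by rewrite oppr_eq0 oner_neq0.
by move=> /(intble_affine c n1); congr (intble _ _); apply/funext => x; rewrite mulN1r addrC.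
Qed.

Lemma intble_scale f b : b != 0 -> intble mu f -> intble mu (fun x => f (b * x)).
Proof.
by move=> b0 /(intble_affine 0 b0); congr (intble _ _); apply/funext => x; rewrite addr0.
Qed.

Lemma Rint_shift f c : intble mu f -> \Rint[mu]_x f (x + c) = \Rint[mu]_x f x.
Proof.
move=> /(Rint_affine c (oner_neq0 R)); rewrite normr1 invr1 mul1r => <-.
by apply: eq_Rint => x; rewrite mul1r.
Qed.

Lemma Rint_reflect f c : intble mu f -> \Rint[mu]_x f (c - x) = \Rint[mu]_x f x.
Proof.
have n1 : -1 != 0 :> R by rewrite oppr_eq0 oner_neq0.
move=> /(Rint_affine c n1); rewrite normrN1 invr1 mul1r => <-.
by apply: eq_Rint => x; rewrite mulN1r addrC.
Qed.

Lemma Rint_scale f b : b != 0 -> intble mu f ->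
  \Rint[mu]_x f (b * x) = `|b|^-1 * \Rint[mu]_x f x.
Proof.
move=> b0 /(Rint_affine 0 b0) <-.
by apply: eq_Rint => x; rewrite addr0.
Qed.

(** A zero integral would force [f] to vanish almost everywhere, but []x, y[] has positive
    measure. *)
Lemma Rint_gt0 f x y : x < y -> intble mu f -> (forall t, 0 <= f t) ->
  (forall t, x < t -> t < y -> 0 < f t) -> 0 < \Rint[mu]_t f t.
Proof.
move=> xy f1 f0 fp; rewrite lt_neqAle Rint_ge0// andbT eq_sym.
apply/negP => /eqP /(Rint_eq0_ae f1 f0) [N [mN N0 subN]].
have : (mu `]x, y[ <= mu N)%E.
  apply: le_measure; rewrite ?inE//= => t /=; rewrite in_itv/= => /andP[xt ty].
  by apply: subN => /= /eqP; rewrite gt_eqF// fp.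
by rewrite N0 lebesgue_measure_itv/= lte_fin xy -EFinB lee_fin leNgt subr_gt0 xy.
Qed.

(* [lebesgue_measure] lives on [measurableTypeR R], whereas [R -> R] is read with the
   default measurable structure of [R]: unification does not identify the two, so the
   general lemmas are restated for functions on [R]. *)
Lemma le_intbleR f g : measurable_fun setT f -> (forall x, `|f x| <= g x) ->
  intble mu g -> intble mu f.
Proof. exact: (@le_intble _ _ _ mu f g). Qed.

Lemma Rint_dominated_cvgR (f_ : nat -> R -> R) f g :
  (forall n, measurable_fun setT (f_ n)) -> intble mu g ->
  (forall n x, `|f_ n x| <= g x) -> (forall x, f_ n x @[n --> \oo] --> f x) ->
  \Rint[mu]_x f_ n x @[n --> \oo] --> \Rint[mu]_x f x.
Proof. exact: (@Rint_dominated_cvg _ _ _ mu f_ f g). Qed.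

End translation_reflection_scaling.

(** * Fubini's theorem for real-valued integrals *)

Section fubini_real.
Context d1 d2 (T1 : measurableType d1) (T2 : measurableType d2) (R : realType).
Variable m1 : {sigma_finite_measure set T1 -> \bar R}.
Variable m2 : {sigma_finite_measure set T2 -> \bar R}.
Variable F : T1 -> T2 -> R.
Hypothesis mF : measurable_fun setT (fun z : T1 * T2 => F z.1 z.2).

Lemma measurable_section2 y : measurable_fun setT (F ^~ y).
Proof. exact: (measurableT_comp mF (pair2_measurable y)). Qed.

(** Tonelli covers nonnegative integrands; the general case is the difference of the integrals of
    [|F|] and [|F| - F]. *)
Lemma measurable_Rint (iF : forall x, intble m2 (F x)) :
  measurable_fun setT (fun x => \Rint[m2]_y F x y).
Proof.
have H (G : T1 -> T2 -> R) : measurable_fun setT (fun z : T1 * T2 => G z.1 z.2) ->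
    (forall x y, 0 <= G x y) -> measurable_fun setT (fun x => \Rint[m2]_y G x y).
  move=> mG G0; rewrite unlock; apply: (measurableT_comp (fine_measurable measurableT)).
  apply: (measurable_fun_fubini_tonelli_F (fun z : T1 * T2 => (G z.1 z.2)%:E)).
    exact/measurable_EFinP.
  by move=> z; rewrite lee_fin.
have -> : (fun x => \Rint[m2]_y F x y) =
    (fun x => \Rint[m2]_y `|F x y| - \Rint[m2]_y (`|F x y| - F x y)).
  apply/funext => x; rewrite -RintB; first by apply: eq_Rint => y; rewrite subKr.
    exact: intble_norm.
  exact/intbleB/iF/intble_norm.
apply: measurable_funB; apply: H => //.
- exact: measurable_fun_norm.
- by apply: measurable_funB => //; exact: measurable_fun_norm.
- by move=> x y; rewrite subr_ge0 ler_norm.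
Qed.

Lemma intble_prod_bound (g : T1 -> R) : intble m1 g ->
  (forall x, (\int[m2]_y `|F x y|%:E <= (g x)%:E)%E) ->
  intble (m1 \x m2)%E (fun z => F z.1 z.2).
Proof.
move=> g1 Fg; split; apply/integrable12ltyP; first exact/measurable_EFinP.
apply: le_lt_trans (intble_lty g1); apply: ge0_le_integral => //.
- by move=> x _; apply: integral_ge0.
- apply: (measurable_fun_fubini_tonelli_F (fun z : T1 * T2 => `|(F z.1 z.2)%:E|%E)) => //.
  by apply: measurableT_comp => //; exact/measurable_EFinP.
- by apply/measurable_EFinP; exact: intble_measurable g1.
- by move=> x _; exact: Fg.
Qed.

Hypothesis iF : intble (m1 \x m2)%E (fun z => F z.1 z.2).

(** Sections are integrable only almost everywhere. On the exceptional null set [fine] may turn an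
    infinite integral into 0, which the outer integral does not see. *)
Let fubini1E : {ae m1, forall x, (\int[m2]_y (F x y)%:E)%E = (\Rint[m2]_y F x y)%:E}.
Proof.
have := ae_integrable1 (intbleP iF); apply: filterS => x Fx.
by rewrite -intbleE.
Qed.

Let fubini2E : {ae m2, forall y, (\int[m1]_x (F x y)%:E)%E = (\Rint[m1]_x F x y)%:E}.
Proof.
have := ae_integrable2 (intbleP iF); apply: filterS => x Fx.
by rewrite -intbleE.
Qed.

Lemma measurable_Rint1 : measurable_fun setT (fun x => \Rint[m2]_y F x y).
Proof.
have := measurable_fubini_F (intbleP iF).
rewrite unlock; exact: measurableT_comp (fine_measurable measurableT).
Qed.

Lemma measurable_Rint2 : measurable_fun setT (fun y => \Rint[m1]_x F x y).
Proof.
have := measurable_fubini_G (intbleP iF).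
rewrite unlock; exact: measurableT_comp (fine_measurable measurableT).
Qed.

Lemma intble_Rint1 : intble m1 (fun x => \Rint[m2]_y F x y).
Proof.
have /integrableP[mG Goo] := integrable_fubini_F (intbleP iF).
split; apply/integrableP; split; first exact/measurable_EFinP/measurable_Rint1.
rewrite (ae_eq_integral (fun x => `|fubini_F m2 (EFin \o (fun z => F z.1 z.2)) x|)%E)//.
- apply: measurableT_comp => //; exact/measurable_EFinP/measurable_Rint1.
- exact: measurableT_comp.
- by apply: filterS fubini1E => x /= Fx _; rewrite /fubini_F /= Fx.
Qed.

Lemma intble_Rint2 : intble m2 (fun y => \Rint[m1]_x F x y).
Proof.
split; apply/integrableP; split; first exact/measurable_EFinP/measurable_Rint2.
have mF' : measurable_fun setT (fun z : T1 * T2 => (F z.1 z.2)%:E) by exact/measurable_EFinP.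
have H := (integrable21ltyP m1 m2 mF').1 (intbleP iF).
apply: le_lt_trans H.
apply: ae_ge0_le_integral => //.
- by apply: measurableT_comp => //; exact/measurable_EFinP/measurable_Rint2.
- by move=> y _; exact: integral_ge0.
- apply: (measurable_fun_fubini_tonelli_G (fun z : T1 * T2 => `|(F z.1 z.2)%:E|%E)) => //.
  exact: measurableT_comp.
- apply: filterS fubini2E => y /= Fy _; rewrite -abse_EFin -Fy.
  apply: le_abse_integral => //.
  by apply/measurable_EFinP; exact: measurable_section2.
Qed.

Lemma Fubini_Rint : \Rint[m1]_x (\Rint[m2]_y F x y) = \Rint[m2]_y (\Rint[m1]_x F x y).
Proof.
have /integrableP[mF1 _] := integrable_fubini_F (intbleP iF).
have mF2 := measurable_fubini_G (intbleP iF).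
have := Fubini (intbleP iF); rewrite /= => H; rewrite (RintE m1) (RintE m2); congr fine.
transitivity (\int[m1]_x \int[m2]_y (F x y)%:E)%E.
  apply: ae_eq_integral => //; first exact/measurable_EFinP/measurable_Rint1.
  by apply: filterS fubini1E => x /= ->.
rewrite H; apply: ae_eq_integral => //; first exact/measurable_EFinP/measurable_Rint2.
by apply: filterS fubini2E => x /= ->.
Qed.

End fubini_real.

Lemma measurable_RintR (R : realType) (F : R -> R -> R) :
  measurable_fun setT (fun z : R * R => F z.1 z.2) ->
  (forall x, intble (@lebesgue_measure R) (F x)) ->
  measurable_fun setT (fun x => \Rint[@lebesgue_measure R]_y F x y).
Proof.
move=> mF iF.
exact: (@measurable_Rint _ _ (measurableTypeR R) (measurableTypeR R) R (@lebesgue_measure R) F mF iF).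
Qed.

Section fubini_lebesgue.
Context (R : realType).
Notation mu := (@lebesgue_measure R).

(** The form of every later exchange: an integrable bound on the norms of the sections replaces
    integrability on the product. *)
Lemma Fubini_R (F : R -> R -> R) (g : R -> R) :
  measurable_fun setT (fun z : R * R => F z.1 z.2) ->
  (forall x, intble mu (F x)) -> intble mu g ->
  (forall x, \Rint[mu]_y `|F x y| <= g x) ->
  [/\ intble mu (fun x => \Rint[mu]_y F x y),
      intble mu (fun y => \Rint[mu]_x F x y) &
      \Rint[mu]_x (\Rint[mu]_y F x y) = \Rint[mu]_y (\Rint[mu]_x F x y)].
Proof.
move=> mF iF ig Fg.
have iFF : intble (mu \x mu)%E (fun z : measurableTypeR R * measurableTypeR R => F z.1 z.2).
  apply: (@intble_prod_bound _ _ (measurableTypeR R) (measurableTypeR R) R mu mu F mF g ig).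
  by move=> x; rewrite intbleE ?lee_fin//; exact: intble_norm.
split.
- exact: (@intble_Rint1 _ _ (measurableTypeR R) (measurableTypeR R) R mu mu F iFF).
- exact: (@intble_Rint2 _ _ (measurableTypeR R) (measurableTypeR R) R mu mu F mF iFF).
- exact: (@Fubini_Rint _ _ (measurableTypeR R) (measurableTypeR R) R mu mu F iFF).
Qed.

End fubini_lebesgue.

(** * Integrability of powers *)

Section powers.
Context (R : realType).
Notation mu := (@lebesgue_measure R).
Implicit Types (x y a b c p q A : R) (f : R -> R).

Lemma powR_continuous p x : 0 < x -> {for x, continuous (fun t => t `^ p)}.
Proof.
by move=> x0; apply/differentiable_continuous/derivable1_diffP/ex_derive/is_derive1_powR.
Qed.

Lemma integral_powR_itv p x y : p != -1 -> 0 < x -> x <= y ->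
  (\int[mu]_(t in `[x, y]) (t `^ p)%:E =
    ((y `^ (p + 1) - x `^ (p + 1)) / (p + 1))%:E)%E.
Proof.
move=> p1 x0; rewrite le_eqVlt => /predU1P[<-|xy].
  by rewrite set_itv1 integral_set1 subrr mul0r.
have p10 : p + 1 != 0 by rewrite addr_eq0.
rewrite (@continuous_FTC2 _ _ (fun t => (p + 1)^-1 * t `^ (p + 1)))//.
- by rewrite -EFinB -mulrBr mulrC.
- apply: continuous_in_subspaceT => t; rewrite inE/= in_itv/= => /andP[xt _].
  by apply: powR_continuous; exact: lt_le_trans xt.
- have cvgF t : 0 < t -> {for t, continuous (fun t => (p + 1)^-1 * t `^ (p + 1))}.
    by move=> t0; apply: cvgM; [exact: cvg_cst|exact: powR_continuous].
  split.
  + move=> t; rewrite in_itv/= => /andP[xt _]; have t0 := lt_trans x0 xt.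
    by apply: derivableM => //; apply/ex_derive/is_derive1_powR.
  + exact/cvg_at_right_filter/cvgF.
  + exact/cvg_at_left_filter/cvgF/(lt_trans x0).
- move=> t; rewrite in_itv/= => /andP[xt _]; have t0 := lt_trans x0 xt.
  have h := is_derive1_powR (p + 1) t0.
  by rewrite derive1E deriveM//= derive_val derive_cst scaler0 addr0 addrK /GRing.scale/= mulrA mulVf// mul1r.
Qed.

Lemma ge0_integral_bigcup_le (F : (set R)^nat) (f : R -> R) (C : \bar R) :
  nondecreasing_seq F -> (forall i, measurable (F i)) ->
  measurable_fun setT f -> (forall x, 0 <= f x) ->
  (forall i, \int[mu]_(x in F i) (f x)%:E <= C)%E ->
  (\int[mu]_(x in \bigcup_i F i) (f x)%:E <= C)%E.
Proof.
move=> ndF mF mf f0 FC.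
have := @ge0_nondecreasing_set_cvg_integral _ (measurableTypeR R) R F (EFin \o f) mu ndF mF.
move=> /(_ _ _)/cvg_lim => <- //.
- apply: lime_le; last by apply: nearW => n; exact: FC.
  apply: ereal_nondecreasing_is_cvgn.
  apply: ge0_nondecreasing_set_nondecreasing_integral => //.
  + by move=> i; apply/measurable_EFinP; exact: measurable_funTS.
  + by move=> i x _; rewrite lee_fin.
- by move=> i; apply/measurable_EFinP; exact: measurable_funTS.
- by move=> i x _; rewrite lee_fin.
Qed.

Lemma integral_powR_near0 b : b < 1 ->
  (\int[mu]_(t in `]0%R, 1%R]) (t `^ (- b))%:E < +oo)%E.
Proof.
move=> b1.
rewrite (_ : `]0, 1]%classic = \bigcup_n `[n.+1%:R^-1, 1 : R]%classic); last first.
  apply/seteqP; split => [x/=|x [n _] /=]; rewrite !in_itv/=.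
    move=> /andP[x0 x1]; exists (Num.truncn x^-1) => //=; rewrite in_itv/= x1 andbT.
    rewrite invf_ple ?posrE//; apply/ltW/truncnS_gt.
  by move=> /andP[nx ->]; rewrite andbT (lt_le_trans _ nx).
apply: (@le_lt_trans _ _ ((1 - b)^-1)%:E); last by rewrite ltry.
apply: ge0_integral_bigcup_le => //.
- move=> i j ij; apply/subsetPset => x/=; rewrite !in_itv/= => /andP[ix ->].
  by rewrite andbT (le_trans _ ix)// lef_pV2 ?posrE// ler_nat.
- by move=> x; exact: powR_ge0.
- move=> i; rewrite integral_powR_itv//; last 2 first.
    by rewrite eqr_opp lt_eqF.
    by rewrite invf_le1// ler1n.
  rewrite lee_fin powR1 [- b + 1]addrC ler_piMl//; by rewrite invr_ge0 subr_ge0 ltW.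
Qed.

Lemma integral_powR_pinfty c : 1 < c ->
  (\int[mu]_(t in `[1%R, +oo[) (t `^ (- c))%:E < +oo)%E.
Proof.
move=> c1.
rewrite (_ : `[1, +oo[%classic = \bigcup_n `[1, n.+1%:R : R]%classic); last first.
  apply/seteqP; split => [x/=|x [n _] /=]; rewrite !in_itv/= ?andbT.
    move=> x1; exists (Num.truncn x) => //=; rewrite in_itv/= x1/=.
    exact/ltW/truncnS_gt.
  by move=> /andP[].
apply: (@le_lt_trans _ _ ((c - 1)^-1)%:E); last by rewrite ltry.
apply: ge0_integral_bigcup_le => //.
- move=> i j ij; apply/subsetPset => x/=; rewrite !in_itv/= => /andP[-> ix].
  by rewrite (le_trans ix)// ler_nat.
- by move=> x; exact: powR_ge0.
- move=> i; rewrite integral_powR_itv ?ler1n//; last by rewrite eqr_opp gt_eqF.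
  rewrite lee_fin powR1 -mulrNN -invrN opprB (_ : - (- c + 1) = c - 1); last by ring.
  rewrite ler_piMl ?invr_ge0 ?subr_ge0 1?ltW//.
Qed.

Lemma intble_patch (D : set R) f : measurable D -> measurable_fun setT f ->
  (forall x, 0 <= f x) -> (\int[mu]_(t in D) (f t)%:E < +oo)%E ->
  intble mu (f \_ D).
Proof.
move=> mD mf f0 H; have : mu.-integrable D (EFin \o f).
  apply/integrableP; split; first by apply/measurable_EFinP; exact: measurable_funTS.
  by under eq_integral do rewrite /= ger0_norm//.
move=> /(@integrable_mkcond _ (measurableTypeR R) R mu D (EFin \o f) mD).1.
by split; rewrite -restrict_EFin.
Qed.

(** Comparison function with separate exponents: [b < 1] controls the origin and [c > 1] controls
    infinity. *)
Definition powR_kernel b c : R -> R := fun x =>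
  if 0 < x then if x <= 1 then x `^ (- b) else x `^ (- c) else 0.

Lemma intble_powR_kernel b c : b < 1 -> 1 < c -> intble mu (powR_kernel b c).
Proof.
move=> b1 c1.
apply: (@le_intbleR _ _ (fun x => ((fun t => t `^ (-b)) \_ `]0, 1]) x +
  ((fun t => t `^ (-c)) \_ `[1, +oo[) x)).
- rewrite /powR_kernel; apply: measurable_fun_ifT => //; last apply: measurable_fun_ifT => //.
  + exact: measurable_fun_ltr.
  + exact: measurable_fun_ler.
- move=> x; rewrite /powR_kernel !patchE !mem_setE !in_itv/= andbT.
  case: ltP => x0; last by rewrite normr0 addr_ge0//; case: ifPn => // _; exact: powR_ge0.
  case: (leP x 1) => x1 /=; rewrite ger0_norm ?powR_ge0//.
    by rewrite lerDl; case: ifPn => // _; exact: powR_ge0.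
  rewrite (ltW x1) [point](_ : _ = 0) ?add0r//.
- apply: intbleD; apply: intble_patch => //; try by meas.
  + by move=> x; exact: powR_ge0.
  + exact: integral_powR_near0.
  + by move=> x; exact: powR_ge0.
  + exact: integral_powR_pinfty.
Qed.

Lemma intble_le_powR b c A (f : R -> R) : b < 1 -> 1 < c -> measurable_fun setT f ->
  (forall x, x <= 0 -> f x = 0) ->
  (forall x, 0 < x -> x <= 1 -> `|f x| <= A * x `^ (- b)) ->
  (forall x, 1 < x -> `|f x| <= A * x `^ (- c)) ->
  intble mu f.
Proof.
move=> b1 c1 mf f0 fb fc; apply: (@le_intbleR _ _ (fun x => A * powR_kernel b c x)) => //.
  move=> x; rewrite /powR_kernel; case: ltP => x0.
    by case: (leP x 1) => x1; [exact: fb|exact: fc].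
  by rewrite f0// normr0 mulr0.
exact/intbleZl/intble_powR_kernel.
Qed.

Lemma intble_le_abs_powR c A (f : R -> R) : 1 < c -> measurable_fun setT f ->
  (forall x, `|x| <= 1 -> `|f x| <= A) ->
  (forall x, 1 < `|x| -> `|f x| <= A * `|x| `^ (- c)) ->
  intble mu f.
Proof.
move=> c1 mf fb fc.
have k1 : intble mu (powR_kernel 0 c) by apply: intble_powR_kernel.
have A0 : 0 <= A by apply: le_trans (fb 0 _) => //; rewrite normr0.
apply: (@le_intbleR _ _ (fun x => A * (\1_(`[-1, 1]) x +
  (powR_kernel 0 c x + powR_kernel 0 c (0 - x))))) => //; last first.
  apply/intbleZl/intbleD; last by apply: intbleD => //; exact: intble_reflect.
  by split; apply: (integrable_indic_itv (-1) 1 true false).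
move=> x; have k0 y : 0 <= powR_kernel 0 c y.
  by rewrite /powR_kernel; do 2 case: ifPn => // _; exact: powR_ge0.
have [x1|x1] := leP `|x| 1.
  rewrite indicE mem_setE in_itv/= -ler_norml x1/=.
  by rewrite (le_trans (fb _ x1))// ler_peMr// lerDl addr_ge0.
rewrite (le_trans (fc _ x1))// ler_wpM2l// indicE mem_setE in_itv/= -ler_norml (leNgt `|x|) x1/= add0r.
rewrite sub0r; case: (ltP 0 x) x1 => [x0|x0].
  rewrite gtr0_norm// => x1; rewrite {1}/powR_kernel x0 (leNgt x) x1/=.
  by rewrite lerDl.
rewrite ler0_norm// => x1; rewrite [X in _ <= _ + X]/powR_kernel.
by rewrite (lt_trans _ x1)// (leNgt (- x)) x1/= lerDr.
Qed.

(** A number in (0, 1] is at most its [a]-th power; this is applied to [x / (x + y)] and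
    [y / (x + y)], whose sum is 1. *)
Lemma powR_subadditive a x y : 0 < a <= 1 -> 0 <= x -> 0 <= y ->
  (x + y) `^ a <= x `^ a + y `^ a.
Proof.
move=> /andP[a0 a1] x0 y0.
have [xy0|xy0] := eqVneq (x + y) 0.
  by rewrite xy0 powR0 ?gt_eqF// addr_ge0 ?powR_ge0.
have xy : 0 < x + y by rewrite lt_neqAle eq_sym xy0 addr_ge0.
have H z : 0 <= z -> z <= x + y -> z / (x + y) * (x + y) `^ a <= z `^ a.
  rewrite le_eqVlt => /predU1P[<-|z0] zxy; first by rewrite !mul0r powR_ge0.
  rewrite -[leRHS](_ : (z / (x + y)) `^ a * (x + y) `^ a = _); last first.
    by rewrite -powRM ?divr_ge0 ?ltW// -mulrA mulVf ?mulr1.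
  rewrite ler_wpM2r ?powR_ge0// ger1_powR// divr_gt0//= ler_pdivrMr// mul1r//.
have := lerD (H x x0 _) (H y y0 _); rewrite -mulrDl -mulrDl divff// mul1r.
by apply; lra.
Qed.

(** This is the triangle inequality for the metric [|x - y|^a], the source of the growth and Hoelder
    bounds on potentials. *)
Lemma abs_powR_subadditive a x y : 0 < a <= 1 -> `|x + y| `^ a <= `|x| `^ a + `|y| `^ a.
Proof.
move=> a01; apply: le_trans (powR_subadditive a01 (normr_ge0 _) (normr_ge0 _)).
by case/andP: a01 => a0 _; apply: ge0_ler_powR; rewrite ?nnegrE ?addr_ge0 ?(ltW a0)// ler_normD.
Qed.

End powers.

(** * Negative type of the kernel |x - y|^a *)

(** The constant bound serves at infinity and the linear one at 0, where [a < 1] makes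
    [t * t^-(1 + a)] integrable. *)
Lemma one_sub_cos_le (R : realType) (x : R) : `|1 - cos x| <= 2 /\ `|1 - cos x| <= `|x|.
Proof.
have c1 := cos_le1 x; have cN1 := cos_geN1 x.
split; first by rewrite ger0_norm; lra.
wlog x0 : x c1 cN1 / 0 <= x => [hw|].
  have [x0|x0] := leP 0 x; first exact: hw.
  have := hw (- x); rewrite cosN normrN; apply => //; lra.
have [->|xp] := eqVneq x 0; first by rewrite cos0 subrr normr0.
have x_gt0 : 0 < x by rewrite lt_neqAle eq_sym xp.
have cos' y : y \in `]0, x[ -> is_derive y 1 cos (- sin y) by move=> _; exact: is_derive_cos.
have ccos : {within `[0, x], continuous (@cos R)}.
  by apply: continuous_subspaceT => y; exact: continuous_cos.
have [c _] := MVT x_gt0 cos' ccos.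
rewrite cos0 subr0 => E; rewrite distrC E normrM normrN ler_piMl// ler_norml.
by rewrite sin_geN1 sin_le1.
Qed.

Section cosine_representation.
Context (R : realType).
Notation mu := (@lebesgue_measure R).
Variable a : R.
Hypothesis a01 : 0 < a < 1.

Definition cos_weight : R -> R := fun t => if 0 < t then t `^ (- (1 + a)) else 0.

Lemma cos_weight_ge0 t : 0 <= cos_weight t.
Proof. by rewrite /cos_weight; case: ifPn => // _; exact: powR_ge0. Qed.

Lemma measurable_cos_weight : measurable_fun setT cos_weight.
Proof.
apply: measurable_fun_ifT => //.
exact: measurable_fun_ltr.
Qed.

Lemma intble_cos_weight : intble mu (fun t => (1 - cos t) * cos_weight t).
Proof.
case/andP: (a01) => a0 a1.
apply: (@intble_le_powR R a (1 + a) 2) => //.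
- by rewrite ltrDl.
- apply: measurable_funM; last exact: measurable_cos_weight.
 by meas.
- by move=> x x0; rewrite /cos_weight ltNge x0/= mulr0.
- move=> x x0 x1; rewrite /cos_weight x0 normrM (ger0_norm (powR_ge0 _ _)).
  rewrite (_ : - a = 1 + - (1 + a)); last by ring.
  rewrite (@powRD _ x 1) ?(gt_eqF x0) ?implybT// powRr1 ?(ltW x0)// mulrA ler_wpM2r ?powR_ge0//.
  by have [_ /le_trans->//] := one_sub_cos_le x; rewrite gtr0_norm//; lra.
- move=> x x1; rewrite /cos_weight (lt_trans _ x1)// normrM (ger0_norm (powR_ge0 _ _)).
  by rewrite ler_wpM2r ?powR_ge0//; have [] := one_sub_cos_le x.
Qed.

Definition cos_cst : R := \Rint[mu]_t ((1 - cos t) * cos_weight t).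

Lemma cos_cst_gt0 : 0 < cos_cst.
Proof.
apply: (@Rint_gt0 _ _ 0 1 ltr01 intble_cos_weight).
  by move=> t; rewrite mulr_ge0 ?cos_weight_ge0// subr_ge0 cos_le1.
move=> t t0 t1; rewrite mulr_gt0//; last by rewrite /cos_weight t0 powR_gt0.
rewrite subr_gt0 -(@cos0 R); rewrite ltr_cos ?in_itv/= ?lexx ?pi_ge0 ?(ltW t0)//=.
by have := pi_ge2 R; lra.
Qed.

Lemma cos_weightM x t : 0 < x -> cos_weight t = x `^ (1 + a) * cos_weight (x * t).
Proof.
move=> x0; rewrite /cos_weight pmulr_rgt0//; case: ltP => t0; last by rewrite mulr0.
by rewrite powRM ?(ltW x0) ?(ltW t0)// mulrA -powRD ?(gt_eqF x0) ?implybT// subrr powRr0 mul1r.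
Qed.

Let cosabs (t x : R) : cos (t * x) = cos (`|x| * t).
Proof.
case: (leP 0 x) => x0; first by rewrite ger0_norm// mulrC.
by rewrite ltr0_norm// mulNr cosN mulrC.
Qed.

Let weightE x t : x != 0 -> (1 - cos (t * x)) * cos_weight t =
  `|x| `^ (1 + a) * ((1 - cos (`|x| * t)) * cos_weight (`|x| * t)).
Proof.
by move=> x0; rewrite cosabs (@cos_weightM `|x|) ?normr_gt0// mulrCA.
Qed.

Lemma intble_cos_weightM x : intble mu (fun t => (1 - cos (t * x)) * cos_weight t).
Proof.
have [->|x0] := eqVneq x 0.
  apply: (@eq_intble _ _ _ mu (fun=> 0)); last exact: intble0.
  by move=> t; rewrite mulr0 cos0 subrr mul0r.
apply: (@eq_intble _ _ _ mu _ _ (fun t => esym (@weightE x t x0))).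
apply: intbleZl; apply: (@intble_scale _ (fun t => (1 - cos t) * cos_weight t)).
  by rewrite normr_eq0.
exact: intble_cos_weight.
Qed.

(** Scaling [t] by [|x|]: the weight is homogeneous of degree [-(1 + a)] and the Jacobian
    contributes [|x|^-1], which leaves [|x|^a]. *)
Lemma Rint_cos_weight x :
  \Rint[mu]_t ((1 - cos (t * x)) * cos_weight t) = cos_cst * `|x| `^ a.
Proof.
case/andP: (a01) => a0 a1.
have [->|x0] := eqVneq x 0.
  rewrite normr0 powR0 ?gt_eqF// mulr0 (@eq_Rint _ _ _ mu _ (fun=> 0)).
    by rewrite RintE integral0.
  by move=> t; rewrite mulr0 cos0 subrr mul0r.
have nx0 : `|x| != 0 by rewrite normr_eq0.
rewrite (eq_Rint mu (fun t => @weightE x t x0)) RintZl; last first.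
  by apply: (@intble_scale _ (fun t => (1 - cos t) * cos_weight t)) => //; exact: intble_cos_weight.
rewrite (@Rint_scale _ (fun t => (1 - cos t) * cos_weight t) `|x|)//; last exact: intble_cos_weight.
rewrite normr_id mulrA mulrC; congr (_ * _).
by rewrite addrC powRD ?nx0 ?implybT// powRr1// mulfK.
Qed.

End cosine_representation.

Section negative_type.
Context (R : realType).
Notation mu := (@lebesgue_measure R).
Variable a : R.
Hypothesis a01 : 0 < a < 1.
Implicit Types p q : R -> R.

Definition density p := [/\ measurable_fun setT p, (forall x, 0 <= p x), intble mu p,
  \Rint[mu]_x p x = 1 & intble mu (fun x => `|x| `^ a * p x)].

Definition riesz q x : R := \Rint[mu]_y (`|x - y| `^ a * q y).

Let a01' : 0 < a <= 1. Proof. by case/andP: a01 => -> /ltW. Qed.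

Lemma intble_riesz q x : density q -> intble mu (fun y => `|x - y| `^ a * q y).
Proof.
move=> [mq q0 q1 _ qm].
apply: (@le_intbleR _ _ (fun y => `|x| `^ a * q y + `|y| `^ a * q y)).
- by meas.
- move=> y; rewrite ger0_norm ?mulr_ge0 ?powR_ge0// -mulrDl ler_wpM2r//.
  by rewrite -(normrN y) abs_powR_subadditive.
- by apply: intbleD => //; exact: intbleZl.
Qed.

Lemma measurable_riesz q : density q -> measurable_fun setT (riesz q).
Proof.
move=> dq; have [mq _ _ _ _] := dq.
apply: (@measurable_RintR _ (fun x y => `|x - y| `^ a * q y)).
- apply: measurable_funM; first by meas.
  exact: (measurableT_comp mq measurable_snd).
- by move=> x; exact: intble_riesz.
Qed.

Lemma riesz_ge0 q x : density q -> 0 <= riesz q x.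
Proof. by case=> _ q0 _ _ _; apply: Rint_ge0 => y; rewrite mulr_ge0 ?powR_ge0. Qed.

Lemma riesz_le q x : density q -> riesz q x <= `|x| `^ a + \Rint[mu]_y (`|y| `^ a * q y).
Proof.
move=> dq; have [mq q0 q1 q2 qm] := dq.
apply: (@le_trans _ _ (\Rint[mu]_y (`|x| `^ a * q y + `|y| `^ a * q y))).
  apply: le_Rint; first exact: intble_riesz.
    by apply: intbleD => //; exact: intbleZl.
  move=> y; rewrite -mulrDl ler_wpM2r//.
  by rewrite -(normrN y) abs_powR_subadditive.
rewrite RintD//; last exact: intbleZl.
by rewrite RintZl// q2 mulr1.
Qed.

Lemma intble_riesz_density p q : density p -> density q ->
  intble mu (fun x => riesz q x * p x).
Proof.
move=> [mp p0 p1 _ pm] dq.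
apply: (@le_intbleR _ _ (fun x => `|x| `^ a * p x + \Rint[mu]_y (`|y| `^ a * q y) * p x)).
- by apply: measurable_funM => //; exact: measurable_riesz.
- move=> x; rewrite ger0_norm ?mulr_ge0 ?riesz_ge0// -mulrDl ler_wpM2r//.
  exact: riesz_le.
- by apply: intbleD => //; exact: intbleZl.
Qed.

Let k := cos_weight a.
(** [fc] and [fs] are the real and imaginary parts of the Fourier transform of [q], up to sign, so
    that complex numbers are avoided. *)
Let fc q t : R := \Rint[mu]_y (cos (t * y) * q y).
Let fs q t : R := \Rint[mu]_y (sin (t * y) * q y).

Let ifc q t : density q -> intble mu (fun y => cos (t * y) * q y).
Proof.
move=> [mq q0 q1 _ _]; apply: (@le_intbleR _ _ q) => //; first by meas.
move=> y; rewrite normrM (ger0_norm (q0 y)) ler_piMl// ler_norml.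
by rewrite cos_geN1 cos_le1.
Qed.

Let ifs q t : density q -> intble mu (fun y => sin (t * y) * q y).
Proof.
move=> [mq q0 q1 _ _]; apply: (@le_intbleR _ _ q) => //; first by meas.
move=> y; rewrite normrM (ger0_norm (q0 y)) ler_piMl// ler_norml.
by rewrite sin_geN1 sin_le1.
Qed.

Let mfc q : density q -> measurable_fun setT (fc q).
Proof.
move=> dq; have [mq _ _ _ _] := dq.
apply: (@measurable_RintR _ (fun t y => cos (t * y) * q y)).
- apply: measurable_funM; first by meas.
  exact: (measurableT_comp mq measurable_snd).
- by move=> t; exact: ifc.
Qed.

Let mfs q : density q -> measurable_fun setT (fs q).
Proof.
move=> dq; have [mq _ _ _ _] := dq.
apply: (@measurable_RintR _ (fun t y => sin (t * y) * q y)).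
- apply: measurable_funM; first by meas.
  exact: (measurableT_comp mq measurable_snd).
- by move=> t; exact: ifs.
Qed.

Let fcs q x t : density q ->
  \Rint[mu]_y ((1 - cos (t * (x - y))) * q y) =
  1 - (cos (t * x) * fc q t + sin (t * x) * fs q t).
Proof.
move=> dq; have [mq q0 q1 q2 qm] := dq.
rewrite (@eq_Rint _ _ _ mu _ (fun y => q y - (cos (t * x) * (cos (t * y) * q y) +
  sin (t * x) * (sin (t * y) * q y)))); last first.
  by move=> y; rewrite mulrBr cosB; ring.
rewrite RintB//; last by apply: intbleD; apply: intbleZl; [exact: ifc|exact: ifs].
rewrite RintD; [|apply: intbleZl; exact: ifc|apply: intbleZl; exact: ifs].
by rewrite !RintZl// ?q2//; [exact: ifs|exact: ifc].
Qed.

(** The kernel is replaced by its cosine integral and the [y]-integral is done first. The integrand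
    is nonnegative with a known [t]-integral, which supplies the Fubini bound. *)
Let riesz_cos q x : density q -> cos_cst a * riesz q x =
  \Rint[mu]_t (k t * (1 - (cos (t * x) * fc q t + sin (t * x) * fs q t))) /\
  intble mu (fun t => k t * (1 - (cos (t * x) * fc q t + sin (t * x) * fs q t))).
Proof.
move=> dq; have [mq q0 q1 q2 qm] := dq.
pose F y t := (1 - cos (t * (x - y))) * k t * q y.
have mF : measurable_fun setT (fun z : R * R => F z.1 z.2).
  apply: measurable_funM; last exact: (measurableT_comp mq measurable_fst).
  apply: measurable_funM; first by meas.
  exact: (measurableT_comp (measurable_cos_weight a) measurable_snd).
have F0 y t : 0 <= F y t.
  by rewrite !mulr_ge0 ?cos_weight_ge0// subr_ge0 cos_le1.
have iF y : intble mu (F y) by apply: intbleZr; exact: intble_cos_weightM.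
have RF y : \Rint[mu]_t F y t = cos_cst a * (`|x - y| `^ a * q y).
  by rewrite RintZr ?Rint_cos_weight ?mulrA//; exact: intble_cos_weightM.
have inner t : \Rint[mu]_y F y t = k t * (1 - (cos (t * x) * fc q t + sin (t * x) * fs q t)).
  rewrite -fcs// -RintZl; first by apply: eq_Rint => y; rewrite /F; ring.
  apply: (@le_intbleR _ _ (fun y => 2 * q y)); [by meas| |exact: intbleZl].
  move=> y; rewrite normrM (ger0_norm (q0 y)) ler_wpM2r//.
  by have [] := one_sub_cos_le (t * (x - y)).
have [|y|_] := @Fubini_R _ F (fun y => cos_cst a * (`|x - y| `^ a * q y)) mF iF.
- by apply: intbleZl; exact: intble_riesz.
- by rewrite -RF (@eq_Rint _ _ _ mu _ (F y))// => t; rewrite ger0_norm.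
rewrite (eq_Rint mu inner) (eq_Rint mu RF) RintZl; last exact: intble_riesz.
by move=> h E; split => //; exact: (@eq_intble _ _ _ mu _ _ inner h).
Qed.

(** The same exchange, now in [x], turns the interaction energy into a weighted integral of 1 minus
    the real inner product of the two transforms. *)
Let energy_cos p q : density p -> density q ->
  cos_cst a * \Rint[mu]_x (riesz q x * p x) =
  \Rint[mu]_t (k t * (1 - (fc p t * fc q t + fs p t * fs q t))) /\
  intble mu (fun t => k t * (1 - (fc p t * fc q t + fs p t * fs q t))).
Proof.
move=> dp dq; have [mp p0 p1 p2 pm] := dp; have [mq q0 q1 q2 qm] := dq.
pose F x t := k t * (1 - (cos (t * x) * fc q t + sin (t * x) * fs q t)) * p x.
have mk := measurable_cos_weight a.
have mF : measurable_fun setT (fun z : R * R => F z.1 z.2).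
  apply: measurable_funM; last exact: (measurableT_comp mp measurable_fst).
  apply: measurable_funM; first exact: (measurableT_comp mk measurable_snd).
  apply: measurable_funB => //; apply: measurable_funD; apply: measurable_funM.
  - by meas.
  - exact: (measurableT_comp (mfc dq) measurable_snd).
  - by meas.
  - exact: (measurableT_comp (mfs dq) measurable_snd).
have F0 x t : 0 <= F x t.
  rewrite !mulr_ge0 ?cos_weight_ge0// -fcs//; apply: Rint_ge0 => y.
  by rewrite mulr_ge0// subr_ge0 cos_le1.
have iF x : intble mu (F x) by apply: intbleZr; have [] := riesz_cos x dq.
have RF x : \Rint[mu]_t F x t = cos_cst a * (riesz q x * p x).
  by have [E i] := riesz_cos x dq; rewrite RintZr// -E mulrA.
have inner t : \Rint[mu]_x F x t = k t * (1 - (fc p t * fc q t + fs p t * fs q t)).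
  rewrite (@eq_Rint _ _ _ mu _ (fun x => k t * (p x - (fc q t * (cos (t * x) * p x) +
     fs q t * (sin (t * x) * p x))))); last by move=> x; rewrite /F; ring.
  have i1 := intbleZl (fc q t) (ifc t dp); have i2 := intbleZl (fs q t) (ifs t dp).
  have i3 := intbleD i1 i2.
  rewrite RintZl; last exact: intbleB.
  rewrite RintB// p2 RintD// !RintZl; [|exact: ifs|exact: ifc].
  by rewrite -/(fc p t) -/(fs p t) (mulrC (fc q t)) (mulrC (fs q t)).
have [|x|_] := @Fubini_R _ F (fun x => cos_cst a * (riesz q x * p x)) mF iF.
- by apply: intbleZl; exact: intble_riesz_density.
- by rewrite -RF (@eq_Rint _ _ _ mu _ (F x))// => t; rewrite ger0_norm.
rewrite (eq_Rint mu inner) (eq_Rint mu RF) RintZl; last exact: intble_riesz_density.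
by move=> h E; split => //; exact: (@eq_intble _ _ _ mu _ _ inner h).
Qed.

(** On the Fourier side the difference of the two sides is the weighted integral of the squared
    modulus of the difference of the transforms. The constants 1 cancel because both masses are
    1. *)
Lemma riesz_negative_type p q : density p -> density q ->
  \Rint[mu]_x (riesz p x * p x) + \Rint[mu]_x (riesz q x * q x) <=
  2 * \Rint[mu]_x (riesz p x * q x).
Proof.
move=> dp dq; have c0 := cos_cst_gt0 a01.
rewrite -(ler_pM2l c0) mulrDr [leRHS]mulrCA.
have [-> i1] := energy_cos dp dp; have [-> i2] := energy_cos dq dq.
have [-> i3] := energy_cos dq dp.
rewrite -RintD// -RintZl//; apply: le_Rint; [exact: intbleD|exact: intbleZl|].
move=> t; rewrite mulrCA -mulrDr ler_wpM2l ?cos_weight_ge0//.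
by have := sqr_ge0 (fc p t - fc q t); have := sqr_ge0 (fs p t - fs q t); nra.
Qed.

End negative_type.

(** * Existence of a mean-field equilibrium *)

Section equicontinuous_extraction.
Context (R : realType).
Variables (f : nat -> R -> R) (b w : R -> R).
Hypothesis fb : forall n x, `|f n x| <= b x.
Hypothesis fw : forall n x y, `|f n x - f n y| <= w (x - y).
Hypothesis w0 : forall e : R, 0 < e -> exists2 d : R, 0 < d & forall h : R, `|h| < d -> w h < e.

(** An ultrafilter finer than [\oo] yields limits at all points at once. Dominated convergence wants
    a sequence, so [phi k] is chosen to match the limit within [1 / (k + 1)] at the first [k]
    rationals, and equicontinuity extends this to the line. *)
Lemma equicontinuous_extraction : exists (phi : nat -> nat) (g : R -> R),
  (forall k, (k <= phi k)%N) /\ (forall x, f (phi k) x @[k --> \oo] --> g x).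
Proof.
have [U [UU ooU]] := @ultraFilterLemma nat \oo _.
have lim_ex x : exists l : R, f n x @[n --> U] --> l.
  have [|l [_ lU]] := @segment_compact R (- b x) (b x) (f ^~ x @ U) _.
    apply: ooU; exists 0%N => // n _ /=; rewrite in_itv/= -ler_norml; exact: fb.
  exists l => B lB; have [//|UB] := in_ultra_setVsetC (f ^~ x @^-1` B) UU.
  by have [y [nBy By]] := lU (~` B) B UB lB.
have [g fg] := choice lim_ex.
pose q i : R := if @unpickle rat i is Some r then ratr r else 0.
have near_g x e : 0 < e -> U [set n | `|f n x - g x| < e].
  by move=> e0; have /cvgrPdist_lt /(_ _ e0) := fg x; apply: filterS => n /=; rewrite distrC.
have ex_phi k : exists n, (k <= n)%N /\ forall i, (i < k)%N -> `|f n (q i) - g (q i)| < k.+1%:R^-1.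
  have Uk j : U [set n | forall i, (i < j)%N -> `|f n (q i) - g (q i)| < k.+1%:R^-1].
    elim: j => [|j IH]; first by apply: filterS filterT.
    have k0 : 0 < k.+1%:R^-1 :> R by rewrite invr_gt0.
    apply: filterS (filterI IH (near_g (q j) _ k0)) => n [/= Hi Hj] i; rewrite ltnS leq_eqVlt => /predU1P[->//|]; exact: Hi.
  have Ug : U [set n | (k <= n)%N] by apply: ooU; exists k.
  by have [n [? ?]] := filter_ex (filterI Ug (Uk k)); exists n.
have [phi phiP] := choice ex_phi; exists phi, g; split; first by move=> k; have [] := phiP k.
move=> x; apply/cvgrPdist_lt => e e0.
have e8 : 0 < e / 8 by lra.
have [d d0 wd] := w0 e8.
have [r] := @rat_in_itvoo R (x - d) (x + d) (ltac:(lra)).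
rewrite in_itv/= => /andP[r1 r2].
have rx : `|ratr r - x| < d by rewrite ltr_norml; apply/andP; split; lra.
have qr : q (pickle r) = ratr r by rewrite /q pickleK.
(* The limit inherits the modulus of continuity through a single index [n] that is good at both
   points; this costs three of the eighths of [e], and two more are spent below. *)
have gg : `|g x - g (ratr r)| < 3 * (e / 8).
  have [n [/= n1 n2]] := filter_ex (filterI (near_g x _ e8) (near_g (ratr r) _ e8)).
  have n3 := le_lt_trans (fw n (ratr r) x) (wd _ rx).
  rewrite (_ : g x - g (ratr r) = - (f n x - g x) - (f n (ratr r) - f n x) +
    (f n (ratr r) - g (ratr r))); last by ring.
  apply: le_lt_trans (ler_normD _ _) _; apply: (@lt_le_trans _ _ (e/8 + e/8 + e/8)); last by lra.
  rewrite ltrD// (le_lt_trans (ler_normB _ _))// ltrD// normrN//.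
near=> k.
have [_ /(_ (pickle r))] := phiP k; rewrite qr => /(_ _) k1.
have {}k1 : `|f (phi k) (ratr r) - g (ratr r)| < k.+1%:R^-1.
  by apply: k1; near: k; exact: nbhs_infty_gt.
have k2 : k.+1%:R^-1 < e / 8.
  rewrite invf_plt ?posrE//; apply: lt_trans (_ : k%:R < _); last by rewrite ltr_nat.
  near: k; exact: nbhs_infty_gtr.
have k3 := le_lt_trans (fw (phi k) (ratr r) x) (wd _ rx).
rewrite (_ : g x - _ = (g x - g (ratr r)) - (f (phi k) (ratr r) - g (ratr r)) +
  (f (phi k) (ratr r) - f (phi k) x)); last by ring.
apply: le_lt_trans (ler_normD _ _) _; apply: (@lt_trans _ _ (3 * (e/8) + e/8 + e/8)); last by lra.
rewrite ltrD// (le_lt_trans (ler_normB _ _))// ltrD// (lt_trans k1)//.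
Unshelve. all: by end_near. Qed.

End equicontinuous_extraction.

(** * The mean-field map and its free energy *)

Section mean_field_iteration.
Context (R : realType).
Notation mu := (@lebesgue_measure R).
Variables a lam : R.
Hypothesis a01 : 0 < a < 1.
Hypothesis lam0 : 0 < lam.
Implicit Types (v w : R -> R).

Let a0 : 0 < a. Proof. by case/andP: a01. Qed.
Let a01' : 0 < a <= 1. Proof. by case/andP: a01 => -> /ltW. Qed.

(** The [k]-th power of [y <= e^y] at [y = c r / k]. *)
Let exp_decay (c r : R) (k : nat) : 0 < c -> (0 < k)%N -> 0 < r ->
  expR (- (c * r)) <= (k%:R / c) ^+ k * (r ^+ k)^-1.
Proof.
move=> c0 k0 r0; have kn : k%:R != 0 :> R by rewrite pnatr_eq0 -lt0n.
have x0 : 0 < c * r / k%:R by rewrite divr_gt0 ?mulr_gt0 ?ltr0n.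
have h : (c * r / k%:R) ^+ k <= expR (c * r).
  rewrite -[in leRHS](divfK kn (c * r)) expRM_natr.
  apply: lerXn2r; rewrite ?nnegrE ?expR_ge0 ?(ltW x0)//.
  by have := expR_ge1Dx (c * r / k%:R); lra.
rewrite expRN [leRHS](_ : _ = ((c * r / k%:R) ^+ k)^-1); last first.
  by rewrite -!exprVn -exprMn; congr (_ ^+ _); field; rewrite kn !gt_eqF.
by rewrite lef_pV2 ?posrE ?exprn_gt0 ?expR_gt0.
Qed.

Lemma intble_expN c : 0 < c -> intble mu (fun x => expR (- (c * `|x| `^ a))).
Proof.
(* With [a k >= 2], decay of order [k] in [|x|^a] is decay at least [|x|^-2]. *)
move=> c0; pose k := (Num.truncn (2 / a)).+1.
have ka : 2 <= a * k%:R.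
  by rewrite mulrC -ler_pdivrMr// ltW// truncnS_gt.
apply: (@intble_le_abs_powR R 2 (1 + (k%:R / c) ^+ k)).
- by rewrite ltr1n.
- by meas; exact: measurable_cst.
- move=> x _; rewrite ger0_norm ?expR_ge0//.
  apply: (@le_trans _ _ 1); last by rewrite lerDl exprn_ge0// divr_ge0// (ltW c0).
  by rewrite expR_le1 oppr_le0 mulr_ge0 ?powR_ge0 ?(ltW c0).
- move=> x x1; rewrite ger0_norm ?expR_ge0//.
  have x0 := lt_trans ltr01 x1.
  apply: le_trans (@exp_decay c _ k c0 (ltn0Sn _) (powR_gt0 a x0)) _.
  have kc : 0 <= (k%:R / c) ^+ k by rewrite exprn_ge0// divr_ge0// (ltW c0).
  rewrite -[(_ `^ a) ^+ _]powR_mulrn ?powR_ge0// -powRrM powRN.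
  apply: (@le_trans _ _ ((k%:R / c) ^+ k * (`|x| `^ 2)^-1)).
    rewrite ler_wpM2l// lef_pV2 ?posrE ?powR_gt0// ler_powR//; exact: ltW.
  by rewrite ler_wpM2r ?invr_ge0 ?powR_ge0// lerDr.
Qed.

(** Half of the exponent absorbs the power: [r e^(- c r / 2) <= 2 / c]. *)
Lemma intble_powR_expN c : 0 < c -> intble mu (fun x => `|x| `^ a * expR (- (c * `|x| `^ a))).
Proof.
move=> c0; have c2 : 0 < c / 2 by rewrite divr_gt0.
apply: (@le_intbleR _ _ (fun x => (2 / c) * expR (- (c / 2 * `|x| `^ a)))); last first.
  exact/intbleZl/intble_expN.
- move=> x; set r := `|x| `^ a; have r0 : 0 <= r by exact: powR_ge0.
  rewrite ger0_norm ?mulr_ge0 ?expR_ge0//.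
  rewrite (_ : - (c * r) = - (c / 2 * r) - (c / 2 * r)); last by field.
  rewrite expRD mulrA ler_wpM2r ?expR_ge0// expRN ler_pdivrMr ?expR_gt0//.
  have := expR_ge1Dx (c / 2 * r); set E := expR _ => h.
  have h2 : c / 2 * r <= E by lra.
  rewrite -(ler_pM2l c2); apply: le_trans h2 _.
  by rewrite mulrA (_ : c / 2 * (2 / c) = 1) ?mul1r//; field; rewrite gt_eqF.
- by meas; exact: measurable_cst.
Qed.

(* e^v is a probability density and v is within bounded distance of -lam |x|^a. *)
Definition profile v := [/\ measurable_fun setT v, (forall x, v (- x) = v x),
  (exists B, forall x, `|v x + lam * `|x| `^ a| <= B) &
  \Rint[mu]_x expR (v x) = 1].

Definition moment v : R := \Rint[mu]_x (`|x| `^ a * expR (v x)).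
Definition pot v : R -> R := riesz a (expR \o v).
Definition mass v : R := \Rint[mu]_x expR (- (lam * pot v x)).
(** [e^(step v)] is the Gibbs density of the field generated by [e^v]. *)
Definition step v : R -> R := fun x => - (lam * pot v x) - ln (mass v).
Definition reference_mass : R := \Rint[mu]_x expR (- (lam * `|x| `^ a)).

Lemma profile_le v B x : (forall x, `|v x + lam * `|x| `^ a| <= B) ->
  expR (v x) <= expR B * expR (- (lam * `|x| `^ a)).
Proof.
by move=> /(_ x) H; rewrite -expRD ler_expR; move: H; rewrite ler_norml => /andP[]; lra.
Qed.

Lemma profile_density v : profile v -> density a (expR \o v).
Proof.
move=> [mv ev [B vB] v1].
have i1 : intble mu (expR \o v).
  apply: (@le_intbleR _ _ (fun x => expR B * expR (- (lam * `|x| `^ a)))).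
  - exact: measurable_fun_expR.
  - by move=> x /=; rewrite ger0_norm ?expR_ge0//; exact: profile_le.
  - exact/intbleZl/intble_expN.
split => //.
- exact: measurable_fun_expR.
- by move=> x; exact: expR_ge0.
- apply: (@le_intbleR _ _ (fun x => expR B * (`|x| `^ a * expR (- (lam * `|x| `^ a))))).
  - by apply: measurable_funM; [meas|exact: measurable_fun_expR].
  - move=> x /=; rewrite ger0_norm ?mulr_ge0 ?powR_ge0 ?expR_ge0// mulrCA.
    by rewrite ler_wpM2l ?powR_ge0//; exact: profile_le.
  - exact/intbleZl/intble_powR_expN.
Qed.

Lemma reference_mass_gt0 c : 0 < c -> 0 < \Rint[mu]_x expR (- (c * `|x| `^ a)).
Proof.
move=> c0; apply: (@Rint_gt0 _ _ 0 1 ltr01 (intble_expN c0)) => t *; first exact: expR_ge0.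
exact: expR_gt0.
Qed.

Lemma pot_le v x : profile v -> pot v x <= `|x| `^ a + moment v.
Proof. by move=> /profile_density dv; exact: riesz_le. Qed.

(** Together with [pot_le] this puts the potential within [moment v] of [|x|^a], so all bounds on
    [step v] depend on [v] through its moment only. *)
Lemma pot_ge v x : profile v -> `|x| `^ a - moment v <= pot v x.
Proof.
move=> /profile_density dv; have [mq q0 q1 q2 qm] := dv.
have -> : `|x| `^ a = \Rint[mu]_y (`|x| `^ a * expR (v y)) by rewrite RintZl// q2 mulr1.
rewrite /moment -RintB//; last exact: intbleZl.
apply: le_Rint; [|exact: intble_riesz|].
  by apply: intbleB => //; exact: intbleZl.
move=> y; rewrite -mulrBl ler_wpM2r ?expR_ge0// lerBlDr.
by rewrite -{1}(subrK y x) abs_powR_subadditive.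
Qed.

(* |2x|^a <= |x - y|^a + |x + y|^a, integrated against an even density. *)
Lemma pot_ge_half v x : profile v -> `|x| `^ a <= 2 * pot v x.
Proof.
move=> pv; have dv := profile_density pv; have [mq q0 q1 q2 qm] := dv.
have [_ ev _ _] := pv.
have iv := intble_riesz a01 x dv.
have E : pot v x = \Rint[mu]_y (`|x + y| `^ a * expR (v y)).
  rewrite /pot /riesz -(Rint_reflect 0 iv); apply: eq_Rint => y /=.
  by rewrite !sub0r opprK ev.
have iv' : intble mu (fun y => `|x + y| `^ a * expR (v y)).
  apply: (@eq_intble _ _ _ mu _ _ _ (intble_reflect 0 iv)) => y /=.
  by rewrite !sub0r opprK ev.
rewrite mulr_natl mulr2n {2}E -RintD//.
have -> : `|x| `^ a = \Rint[mu]_y (`|x| `^ a * expR (v y)) by rewrite RintZl// q2 mulr1.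
apply: le_Rint; [exact: intbleZl|exact: intbleD|].
move=> y /=; rewrite -mulrDl ler_wpM2r ?expR_ge0//.
apply: le_trans (abs_powR_subadditive _ _ a01').
rewrite (_ : x - y + (x + y) = 2 * x); last by ring.
apply: ge0_ler_powR; rewrite ?nnegrE ?(ltW a0)//.
by rewrite normrM ger0_norm// ler_peMl// ler1n.
Qed.

Lemma measurable_pot v : profile v -> measurable_fun setT (pot v).
Proof. by move=> /profile_density dv; exact: measurable_riesz. Qed.

Lemma intble_exp_pot v : profile v -> intble mu (fun x => expR (- (lam * pot v x))).
Proof.
move=> pv; apply: (@le_intbleR _ _ (fun x => expR (lam * moment v) * expR (- (lam * `|x| `^ a)))).
- apply: measurable_fun_expR; apply: measurable_fun_opp; apply: measurable_funM => //.
  exact: measurable_pot.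
- move=> x; rewrite ger0_norm ?expR_ge0// -expRD ler_expR.
  by have := pot_ge x pv; rewrite -(ler_pM2l lam0); lra.
- exact/intbleZl/intble_expN.
Qed.

Lemma mass_bounds v : profile v ->
  expR (- (lam * moment v)) * reference_mass <= mass v /\ mass v <= expR (lam * moment v) * reference_mass.
Proof.
move=> pv; have ig := intble_expN lam0; rewrite /reference_mass -!(RintZl _ ig); split.
- apply: le_Rint; [exact/intbleZl/intble_expN|exact: intble_exp_pot|].
  move=> x; rewrite -expRD ler_expR.
  by have := pot_le x pv; rewrite -(ler_pM2l lam0); lra.
- apply: le_Rint; [exact: intble_exp_pot|exact/intbleZl/intble_expN|].
  move=> x; rewrite -expRD ler_expR.
  by have := pot_ge x pv; rewrite -(ler_pM2l lam0); lra.
Qed.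

Lemma mass_gt0 v : profile v -> 0 < mass v.
Proof.
move=> pv; have [+ _] := mass_bounds pv; apply: lt_le_trans.
by rewrite mulr_gt0 ?expR_gt0// reference_mass_gt0.
Qed.

Lemma ln_mass v : profile v -> `|ln (mass v)| <= lam * moment v + `|ln reference_mass|.
Proof.
move=> pv; have g0 := reference_mass_gt0 lam0; rewrite -/reference_mass in g0; have m0 := mass_gt0 pv.
have [h1 h2] := mass_bounds pv.
have e1 : ln (expR (- (lam * moment v)) * reference_mass) <= ln (mass v).
  by rewrite ler_ln ?posrE// mulr_gt0 ?expR_gt0.
have e2 : ln (mass v) <= ln (expR (lam * moment v) * reference_mass).
  by rewrite ler_ln ?posrE// mulr_gt0 ?expR_gt0.
move: e1 e2; rewrite !lnM ?posrE ?expR_gt0// !expRK.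
have := ler_norm (ln reference_mass); have := ler_normr (- ln reference_mass) (ln reference_mass); rewrite lexx orbT => /idP.
by rewrite ler_norml => *; apply/andP; split; lra.
Qed.

Lemma step_bound v x : profile v ->
  `|step v x + lam * `|x| `^ a| <= 2 * (lam * moment v) + `|ln reference_mass|.
Proof.
move=> pv; have := ln_mass pv; have := pot_le x pv; have := pot_ge x pv.
rewrite -(ler_pM2l lam0) -[_ <= _ + _](ler_pM2l lam0) !ler_norml /step.
by move=> ? ? /andP[? ?]; apply/andP; split; lra.
Qed.

(** The kernel itself is Hoelder with constant 1 in [x], and averaging against a probability density
    keeps the constant: equicontinuity costs no moment bound. *)
Lemma pot_holder v x y : profile v -> `|pot v x - pot v y| <= `|x - y| `^ a.
Proof.
move=> /profile_density dv; have [mq q0 q1 q2 qm] := dv.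
have ix := intble_riesz a01 x dv; have iy := intble_riesz a01 y dv.
rewrite /pot /riesz -RintB//.
have -> : `|x - y| `^ a = \Rint[mu]_z (`|x - y| `^ a * expR (v z)) by rewrite RintZl// q2 mulr1.
apply: ler_norm_Rint; [exact: intbleB|exact: intbleZl|].
move=> z; rewrite -mulrBl normrM (ger0_norm (expR_ge0 _)) ler_wpM2r ?expR_ge0//.
have := abs_powR_subadditive (x - y) (y - z) a01'.
have := abs_powR_subadditive (y - x) (x - z) a01'.
rewrite !addrA !subrK -(distrC x y) ler_norml => *; apply/andP; split; lra.
Qed.

Lemma pot_even v x : profile v -> pot v (- x) = pot v x.
Proof.
move=> pv; have dv := profile_density pv; have [_ ev _ _] := pv.
rewrite /pot /riesz -[RHS](Rint_reflect 0 (intble_riesz a01 x dv)); apply: eq_Rint => y /=.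
by rewrite sub0r ev opprK -normrN opprD !opprK.
Qed.

Lemma step_profile v : profile v -> profile (step v).
Proof.
move=> pv; have m0 := mass_gt0 pv; split.
- apply: measurable_funB => //; apply: measurable_fun_opp; apply: measurable_funM => //.
  exact: measurable_pot.
- by move=> x; rewrite /step pot_even.
- by exists (2 * (lam * moment v) + `|ln reference_mass|) => x; exact: step_bound.
- rewrite (@eq_Rint _ _ _ mu _ (fun x => (mass v)^-1 * expR (- (lam * pot v x)))).
    by rewrite RintZl ?mulVf ?gt_eqF//; exact: intble_exp_pot.
  by move=> x; rewrite /step expRD (expRN (ln _)) lnK ?posrE// mulrC.
Qed.

Lemma step_holder v x y : profile v -> `|step v x - step v y| <= lam * `|x - y| `^ a.
Proof.
move=> pv; rewrite /step (_ : _ - _ - _ = - (lam * (pot v x - pot v y))); last by ring.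
by rewrite normrN normrM (gtr0_norm lam0) ler_wpM2l ?(ltW lam0)// pot_holder.
Qed.

Lemma intble_profile_exp v w : profile v -> profile w -> intble mu (fun x => w x * expR (v x)).
Proof.
move=> pv [mw _ [B wB] _]; have [mq q0 q1 _ qm] := profile_density pv.
apply: (@le_intbleR _ _ (fun x => B * expR (v x) + lam * (`|x| `^ a * expR (v x)))).
- by apply: measurable_funM => //; exact: mq.
- move=> x; rewrite normrM (ger0_norm (expR_ge0 _)) mulrA -mulrDl ler_wpM2r ?expR_ge0//.
  have := wB x; have : 0 <= lam * `|x| `^ a by rewrite mulr_ge0 ?powR_ge0 ?(ltW lam0).
  by rewrite !ler_norml => ? /andP[? ?]; apply/andP; split; lra.
- by apply: intbleD; exact: intbleZl.
Qed.

(** Integrate [e^v (1 + w - v) <= e^w], which is [1 + t <= e^t] at [t = w - v]; the two masses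
    cancel. *)
Lemma gibbs v w : intble mu (expR \o v) -> intble mu (expR \o w) ->
  \Rint[mu]_x expR (v x) = 1 -> \Rint[mu]_x expR (w x) = 1 ->
  intble mu (fun x => v x * expR (v x)) -> intble mu (fun x => w x * expR (v x)) ->
  \Rint[mu]_x (w x * expR (v x)) <= \Rint[mu]_x (v x * expR (v x)).
Proof.
move=> iv iw v1 w1 ivv iwv.
have : \Rint[mu]_x ((w x * expR (v x) - v x * expR (v x)) + expR (v x)) <= \Rint[mu]_x expR (w x).
  apply: le_Rint => //; first by apply: intbleD => //; exact: intbleB.
  move=> x; rewrite -mulrBl -{2}(mul1r (expR (v x))) -mulrDl.
  rewrite -ler_pdivlMr ?expR_gt0// -expRB addrC; exact: expR_ge1Dx.
rewrite RintD//; last exact: intbleB.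
by rewrite RintB// v1 w1; lra.
Qed.

(* [gap v] below is the relative entropy of e^v with respect to e^(step v). *)
Definition entropy v : R := \Rint[mu]_x (v x * expR (v x)).
Definition energy v : R := entropy v + lam / 2 * \Rint[mu]_x (pot v x * expR (v x)).
Definition gap v : R := entropy v - \Rint[mu]_x (step v x * expR (v x)).

Lemma gap_ge0 v : profile v -> 0 <= gap v.
Proof.
move=> pv; have ps := step_profile pv.
have [_ _ i1 _ _] := profile_density pv; have [_ _ i2 _ _] := profile_density ps.
rewrite subr_ge0; apply: gibbs => //.
- by case: pv.
- by case: ps.
- exact: intble_profile_exp.
- exact: intble_profile_exp.
Qed.

Lemma step_exp v w : profile v -> profile w ->
  \Rint[mu]_x (step v x * expR (w x)) =
  - lam * \Rint[mu]_x (pot v x * expR (w x)) - ln (mass v).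
Proof.
move=> pv pw; have dw := profile_density pw; have dv := profile_density pv.
have [_ _ iw w1 _] := dw; have ip := intble_riesz_density a01 dw dv.
rewrite (@eq_Rint _ _ _ mu _ (fun x => - lam * (pot v x * expR (w x)) - ln (mass v) * expR (w x))).
  rewrite RintB; [|exact: intbleZl|exact: intbleZl].
  rewrite RintZl// RintZl//.
  by have -> : \Rint[mu]_x expR (w x) = 1; [exact: w1|rewrite mulr1].
by move=> x; rewrite /step; ring.
Qed.

(* Negative type makes the interaction energy concave, so it lies below its
   linearisation at v, which [step] minimises together with the entropy. *)
Lemma energy_decrease v : profile v -> gap v <= energy v - energy (step v).
Proof.
move=> pv; have ps := step_profile pv.
have := riesz_negative_type a01 (profile_density pv) (profile_density ps).
have E : entropy (step v) = _ := step_exp pv ps.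
(* The terms [ln (mass v)] and the entropy of [v] cancel, and the difference of the two sides is
   [lam / 2] times the negative-type inequality. *)
rewrite /energy /gap E step_exp// -(ler_pM2l lam0) /pot /=; lra.
Qed.

(* Gibbs' inequality against exp (- lam |x|^a / 8) absorbs the entropy in half of the
   lower bound lam / 4 * moment coming from [pot_ge_half]. *)
Lemma energy_coercive v : profile v ->
  lam / 8 * moment v - ln (\Rint[mu]_x expR (- (lam / 8 * `|x| `^ a))) <= energy v.
Proof.
move=> pv; have dv := profile_density pv; have [mq q0 q1 q2 qm] := dv.
have l8 : 0 < lam / 8 by rewrite divr_gt0.
set Z := \Rint[mu]_x _; have Z0 : 0 < Z by exact: reference_mass_gt0.
pose w (x : R) := - (lam / 8 * `|x| `^ a) - ln Z.
have wE x : expR (w x) = Z^-1 * expR (- (lam / 8 * `|x| `^ a)).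
  by rewrite /w expRD (expRN (ln _)) lnK ?posrE// mulrC.
have iw : intble mu (expR \o w).
  by apply: (@eq_intble _ _ _ mu _ _ (fun x => esym (wE x))); exact/intbleZl/intble_expN.
have w1 : \Rint[mu]_x expR (w x) = 1.
  by rewrite (eq_Rint mu wE) RintZl ?mulVf ?gt_eqF//; exact: intble_expN.
have wvE x : w x * expR (v x) = - (lam / 8) * (`|x| `^ a * expR (v x)) - ln Z * expR (v x).
  by rewrite /w; ring.
have iwv : intble mu (fun x => w x * expR (v x)).
  apply: (@eq_intble _ _ _ mu _ _ (fun x => esym (wvE x))).
  by apply: intbleB; exact: intbleZl.
have := gibbs q1 iw q2 w1 (intble_profile_exp pv pv) iwv.
rewrite (eq_Rint mu wvE) RintB; [|exact: intbleZl|exact: intbleZl].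
rewrite !RintZl// q2 mulr1 -/(entropy v) -/(moment v) /energy => h1.
have : moment v <= 2 * \Rint[mu]_x (pot v x * expR (v x)).
  rewrite -RintZl; last exact: intble_riesz_density.
  apply: le_Rint => //; first by apply: intbleZl; exact: intble_riesz_density.
  by move=> x; rewrite mulrA ler_wpM2r ?expR_ge0// pot_ge_half.
rewrite -(ler_pM2l lam0); lra.
Qed.

End mean_field_iteration.

(** * Passage to the limit in the iteration *)

Section mean_field_limit.
Context (R : realType).
Notation mu := (@lebesgue_measure R).
Variables a lam : R.
Hypothesis a01 : 0 < a < 1.
Hypothesis lam0 : 0 < lam.

Let a0 : 0 < a. Proof. by case/andP: a01. Qed.
Let a01' : 0 < a <= 1. Proof. by case/andP: a01 => -> /ltW. Qed.

(** The image of a unit point mass at 0 under the mean-field map: an even starting profile with an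
    explicit bound. *)
Let v0 (x : R) := - (lam * `|x| `^ a) - ln (reference_mass a lam).
Let u n : R -> R := iter n (step a lam) v0.

Let v0_profile : profile a lam v0.
Proof.
have g0 := reference_mass_gt0 a01 lam0; rewrite -/(reference_mass a lam) in g0; split.
- by rewrite /v0; meas; exact: measurable_cst.
- by move=> x; rewrite /v0 normrN.
- exists `|ln (reference_mass a lam)| => x.
  by rewrite /v0 addrAC addNr add0r normrN.
- rewrite (@eq_Rint _ _ _ mu _ (fun x => (reference_mass a lam)^-1 * expR (- (lam * `|x| `^ a)))).
    by rewrite RintZl ?mulVf ?gt_eqF//; exact: intble_expN.
  by move=> x; rewrite /v0 expRD (expRN (ln _)) lnK ?posrE// mulrC.
Qed.

Let u_profile n : profile a lam (u n).
Proof. by elim: n => [//|n IH]; rewrite /u iterS; exact: step_profile. Qed.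

Let moment_ge0 v : 0 <= moment a v.
Proof. by apply: Rint_ge0 => x; rewrite mulr_ge0 ?powR_ge0 ?expR_ge0. Qed.

Let energy_le n : energy a lam (u n) <= energy a lam v0.
Proof.
elim: n => [//|n]; apply: le_trans.
have := energy_decrease a01 lam0 (u_profile n).
by have := gap_ge0 a01 lam0 (u_profile n); rewrite /u iterS; lra.
Qed.

Let Z := \Rint[mu]_x expR (- (lam / 8 * `|x| `^ a)).
(** The value that [energy_coercive] gives for the moment once the energy is at most its initial
    value. *)
Let M := 8 / lam * (energy a lam v0 + ln Z).

Let moment_le n : moment a (u n) <= M.
Proof.
have := energy_coercive a01 lam0 (u_profile n); rewrite -/Z; have := energy_le n => h1 h2.
rewrite /M -ler_pdivrMl ?divr_gt0// invf_div; lra.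
Qed.

Let B := 2 * (lam * M) + `|ln (reference_mass a lam)|.

Let step_u_bound n x : `|step a lam (u n) x + lam * `|x| `^ a| <= B.
Proof.
apply: le_trans (step_bound a01 lam0 x (u_profile n)) _.
by rewrite lerD2r ler_pM2l// ler_pM2l.
Qed.

Let M0 : 0 <= M. Proof. exact: le_trans (moment_ge0 _) (moment_le 0). Qed.

Let u_bound n x : `|u n x + lam * `|x| `^ a| <= B.
Proof.
case: n => [|n]; last by rewrite /u iterS; exact: step_u_bound.
rewrite /u /= /v0 addrAC addNr add0r normrN lerDr.
by rewrite mulr_ge0// mulr_ge0// ltW.
Qed.

Let u_holder n x y : `|u n x - u n y| <= lam * `|x - y| `^ a.
Proof.
case: n => [|n]; last by rewrite /u iterS; exact: (step_holder a01 lam0 x y (u_profile n)).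
rewrite /u /= /v0 (_ : _ - _ - _ = lam * (`|y| `^ a - `|x| `^ a)); last by ring.
rewrite normrM (gtr0_norm lam0) ler_wpM2l ?(ltW lam0)//.
have := abs_powR_subadditive (x - y) y a01'.
have := abs_powR_subadditive (y - x) x a01'.
by rewrite !subrK -(distrC x y) ler_norml => *; apply/andP; split; lra.
Qed.

(** The energies decrease and [energy_coercive] bounds them below, so consecutive differences, which
    dominate the gaps, tend to 0. *)
Let gap_cvg : gap a lam (u n) @[n --> \oo] --> 0.
Proof.
pose e n := energy a lam (u n).
have ge n : gap a lam (u n) <= e n - e n.+1.
  by have := energy_decrease a01 lam0 (u_profile n); rewrite /e /u iterS.
have ce : cvgn e.
  apply: nonincreasing_is_cvgn.
    apply/nonincreasing_seqP => n; rewrite -subr_ge0; apply: le_trans (ge n).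
    exact: gap_ge0.
  exists (- ln Z) => _ [n _ <-]; have := energy_coercive a01 lam0 (u_profile n).
  have : 0 <= lam / 8 * moment a (u n) by rewrite mulr_ge0// divr_ge0// ltW.
  by rewrite -/Z /e; lra.
apply: (@squeeze_cvgr _ _ _ _ (fun=> 0) (fun n => e n - e n.+1)).
- by apply: nearW => n; rewrite ge gap_ge0.
- exact: cvg_cst.
- rewrite -(subrr (lim (e @ \oo))); apply: cvgB => //.
  by rewrite cvg_shiftS.
Qed.

Lemma mean_field_solution : exists (v : R -> R) (K B' : R), [/\ measurable_fun setT v,
  (forall x, `|v x + lam * `|x| `^ a| <= B'),
  density a (expR \o v) &
  forall x, v x = - (lam * riesz a (expR \o v) x) - K].
Proof.
have [||e e0|phi [g [phik ug]]] := @equicontinuous_extraction R u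
  (fun x => B + lam * `|x| `^ a) (fun h => lam * `|h| `^ a).
- move=> n x; have := u_bound n x; have : 0 <= lam * `|x| `^ a.
    by rewrite mulr_ge0 ?powR_ge0 ?(ltW lam0).
  by rewrite !ler_norml => ? /andP[? ?]; apply/andP; split; lra.
- exact: u_holder.
- have el : 0 < e / lam by rewrite divr_gt0.
  exists ((e / lam) `^ a^-1); first exact: powR_gt0.
  move=> h hd; rewrite mulrC -ltr_pdivlMr//.
  have -> : e / lam = ((e / lam) `^ a^-1) `^ a.
    by rewrite -powRrM mulVf ?gt_eqF// powRr1// ltW.
  by apply: gt0_ltr_powR; rewrite ?nnegrE ?powR_ge0.
have gB x : `|g x + lam * `|x| `^ a| <= B.
  have /cvg_norm h : u (phi k) x + lam * `|x| `^ a @[k --> \oo] --> g x + lam * `|x| `^ a.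
    by apply: cvgD; [exact: ug|exact: cvg_cst].
  by apply: (cvgr_to_le h); apply: nearW => k; exact: u_bound.
(* One integrable envelope for all iterates: no mass escapes to infinity, and every integral below
   passes to the limit by domination. *)
have exp_le k x : `|expR (u (phi k) x)| <= expR B * expR (- (lam * `|x| `^ a)).
  by rewrite ger0_norm ?expR_ge0//; apply: profile_le => y; exact: u_bound.
have idom := intbleZl (expR B) (intble_expN a01 lam0).
have mu_ k : measurable_fun setT (u (phi k)) by have [] := u_profile (phi k).
have ecvg x : expR (u (phi k) x) @[k --> \oo] --> expR (g x).
  by apply: continuous_cvg; [exact: continuous_expR|exact: ug].
have gp : profile a lam g.
  split.
  - by apply: (measurable_fun_cvg mu_) => x _; exact: ug.
  - move=> x; have := ug (- x).
    rewrite (_ : (fun k => _) = (fun k => u (phi k) x)); last first.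
      by apply/funext => k; have [_ -> _ _] := u_profile (phi k).
    by move=> h; exact: cvg_unique h (ug x).
  - by exists B.
  - have := Rint_dominated_cvgR (fun k => measurable_fun_expR (mu_ k)) idom exp_le ecvg.
    rewrite (_ : (fun k => _) = (fun=> 1)); last first.
      by apply/funext => k; have [_ _ _] := u_profile (phi k).
    move=> h; exact: cvg_unique h (cvg_cst _).
have pot_cvg x : pot a (u (phi k)) x @[k --> \oo] --> pot a g x.
  apply: (@Rint_dominated_cvgR R (fun k y => `|x - y| `^ a * expR (u (phi k) y)) _
    (fun y => expR B * (`|x| `^ a * expR (- (lam * `|y| `^ a)) +
                        `|y| `^ a * expR (- (lam * `|y| `^ a))))).
  - by move=> k; apply: measurable_funM; [meas|exact: measurable_fun_expR].
  - by apply/intbleZl/intbleD; [exact/intbleZl/intble_expN|exact: intble_powR_expN].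
  - move=> k y; rewrite normrM ger0_norm ?powR_ge0// -mulrDl mulrCA.
    apply: ler_pM; rewrite ?powR_ge0//.
    by rewrite -(normrN y) abs_powR_subadditive.
  - by move=> y; apply: cvgM; [exact: cvg_cst|exact: ecvg].
have mass_cvg : mass a lam (u (phi k)) @[k --> \oo] --> mass a lam g.
  apply: (@Rint_dominated_cvgR R (fun k y => expR (- (lam * pot a (u (phi k)) y))) _
    (fun y => expR (lam * M) * expR (- (lam * `|y| `^ a)))).
  - move=> k; apply: measurable_fun_expR; apply: measurable_fun_opp; apply: measurable_funM => //.
    exact: (measurable_pot a01 lam0).
  - exact/intbleZl/intble_expN.
  - move=> k x; rewrite ger0_norm ?expR_ge0// -expRD ler_expR.
    have h1 := ler_wpM2l (ltW lam0) (moment_le (phi k)).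
    have h2 := ler_wpM2l (ltW lam0) (pot_ge a01 lam0 x (u_profile (phi k))).
    move: h1 h2; rewrite mulrBr.
    move: (lam * M) (lam * moment _ _) (lam * `|x| `^ a) (lam * pot _ _ _) => p q r t; lra.
  - move=> x; apply: continuous_cvg; first exact: continuous_expR.
    by apply: cvgN; apply: cvgM; [exact: cvg_cst|exact: pot_cvg].
have step_cvg x : step a lam (u (phi k)) x @[k --> \oo] --> step a lam g x.
  apply: cvgB; first by apply: cvgN; apply: cvgM; [exact: cvg_cst|exact: pot_cvg].
  by apply: continuous_cvg; [exact/continuous_ln/mass_gt0|exact: mass_cvg].
(* Written as one integral, the gap has a difference in which the two terms [lam |x|^a] cancel;
   along the iterates it is bounded by [2 B]. *)
have gapE v : profile a lam v -> gap a lam v = \Rint[mu]_x ((v x - step a lam v x) * expR (v x)).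
  move=> pv; rewrite /gap /entropy -RintB.
  - by apply: eq_Rint => x; rewrite [in RHS]mulrBl.
  - exact: (intble_profile_exp a01 lam0 pv pv).
  - exact: (intble_profile_exp a01 lam0 pv (step_profile a01 lam0 pv)).
have gap0 : gap a lam g = 0.
  have h1 : gap a lam (u (phi k)) @[k --> \oo] --> 0.
    apply: (cvg_comp phi (fun n => gap a lam (u n)) _ gap_cvg).
    move=> A [N _ NA]; exists N => // k Nk; apply: NA => /=; exact: leq_trans (phik k).
  have h2 : gap a lam (u (phi k)) @[k --> \oo] --> gap a lam g.
    rewrite gapE//; under eq_cvg do rewrite gapE//.
    apply: (@Rint_dominated_cvgR R
      (fun k x => (u (phi k) x - step a lam (u (phi k)) x) * expR (u (phi k) x)) _
      (fun y => (2 * B) * (expR B * expR (- (lam * `|y| `^ a))))).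
    + move=> k; apply: measurable_funM; last exact: measurable_fun_expR.
      apply: measurable_funB => //.
      by have [] := step_profile a01 lam0 (u_profile (phi k)).
    + exact: intbleZl.
    + move=> k x; rewrite normrM; apply: ler_pM => //.
      have := u_bound (phi k) x; have := step_u_bound (phi k) x.
      by rewrite !ler_norml => /andP[? ?] /andP[? ?]; apply/andP; split; lra.
    + move=> x; apply: cvgM; last exact: ecvg.
      by apply: cvgB; [exact: ug|exact: step_cvg].
  exact: cvg_unique h2 h1.
have sp := step_profile a01 lam0 gp.
have dg := profile_density a01 lam0 gp; have ds := profile_density a01 lam0 sp.
have [mg _ ig g1 _] := dg; have [ms _ is_ s1 _] := ds.
have igs : intble mu (fun x => (g x - step a lam g x) * expR (g x)).
  apply: (@eq_intble _ _ _ mu _ _ _ (intbleB (intble_profile_exp a01 lam0 gp gp)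
    (intble_profile_exp a01 lam0 gp sp))) => x.
  by rewrite [in RHS]mulrBl.
(* The pointwise form of the relative entropy: since both masses are 1 its integral is the gap, and
   strict convexity of the exponential makes it vanish only where [g] and its image agree. *)
pose h x := (expR (step a lam g x) - expR (g x)) + (g x - step a lam g x) * expR (g x).
have ih : intble mu h by apply: intbleD => //; exact: intbleB.
have h0 x : 0 <= h x.
  rewrite /h (_ : expR (step a lam g x) = expR (step a lam g x - g x) * expR (g x)).
    rewrite -[X in _ - X]mul1r -mulrBl -mulrDl mulr_ge0 ?expR_ge0//.
    by have := expR_ge1Dx (step a lam g x - g x); lra.
  by rewrite -expRD subrK.
have hI : \Rint[mu]_x h x = 0.
  rewrite RintD//; last exact: intbleB.
  by rewrite RintB// g1 s1 subrr add0r -gapE.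
have gs : {ae mu, forall x, expR (g x) = expR (step a lam g x)}.
  have := Rint_eq0_ae ih h0 hI; apply: filterS => x; rewrite /h.
  rewrite (_ : expR (step a lam g x) = expR (step a lam g x - g x) * expR (g x)); last first.
    by rewrite -expRD subrK.
  rewrite -[X in _ - X]mul1r -mulrBl -mulrDl => /eqP; rewrite mulf_eq0 expR_eq0 orbF => /eqP E.
  have [->|d0] := eqVneq (step a lam g x - g x) 0; first by rewrite expR0 mul1r.
  by have := expR_gt1Dx d0; lra.
(* The equality with [g] holds only almost everywhere. The potential does not distinguish the two
   densities, so [step a lam g] solves the equation at every point. *)
exists (step a lam g), (ln (mass a lam g)), (2 * (lam * moment a g) + `|ln (reference_mass a lam)|).
split => //.
- by have [] := sp.
- by move=> x; exact: step_bound.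
- move=> x; rewrite {1}/step; congr (- (_ * _) - _).
  apply: (@ae_eq_Rint _ _ _ mu).
  + by apply: measurable_funM; [meas|exact: mg].
  + by apply: measurable_funM; [meas|exact: ms].
  + case: gs => N [mN N0 sN]; exists N; split => // y /= ne; apply: sN => /= e.
    by apply: ne; rewrite e.
Qed.

End mean_field_limit.

(** * The fractional Laplacian and the kernel |x - y|^a *)

Section signed_power.
Context (R : realType).
Notation mu := (@lebesgue_measure R).
Variable a : R.
Hypothesis a01 : 0 < a < 1.

Let a0 : 0 < a. Proof. by case/andP: a01. Qed.
Let a1 : a < 1. Proof. by case/andP: a01. Qed.
Let a01' : 0 < a <= 1. Proof. by rewrite a0 ltW. Qed.

Lemma abs_powR_continuous : continuous (fun x : R => `|x| `^ a).
Proof.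
move=> x; apply/cvgrPdist_lt => e e0.
near=> y.
have : `|x - y| `^ a < e.
  have -> : e = (e `^ a^-1) `^ a by rewrite -powRrM mulVf ?gt_eqF// powRr1// ltW.
  apply: gt0_ltr_powR; rewrite ?nnegrE ?powR_ge0//.
  near: y; apply: cvgr_dist_lt; [exact: cvg_id|exact: powR_gt0].
apply: le_lt_trans.
have := abs_powR_subadditive (x - y) y a01'.
have := abs_powR_subadditive (y - x) x a01'.
by rewrite !subrK -(distrC x y) ler_norml => *; apply/andP; split; lra.
Unshelve. all: by end_near. Qed.

Definition spow (z : R) : R := z * `|z| `^ a / (1 + a).

Lemma spowN z : spow (- z) = - spow z.
Proof. by rewrite /spow normrN; ring. Qed.

Let is_derive_spow_gt0 (z : R) : 0 < z -> is_derive z 1 spow (`|z| `^ a).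
Proof.
move=> z0; have h := is_derive1_powR (a + 1) z0.
have a10 : 1 + a != 0 by rewrite gt_eqF// addr_gt0.
have h1 : is_derive z 1 ((1 + a)^-1 \*: (fun t : R => t `^ (a + 1))) (`|z| `^ a).
  apply: is_derive_eq.
  by rewrite addrK gtr0_norm// /GRing.scale/= (addrC a) mulrA mulVf ?mul1r.
apply: near_eq_is_derive h1; near=> t.
have t0 : 0 < t by near: t; exact: lt_nbhsr.
rewrite /= /spow gtr0_norm// powRD ?(gt_eqF t0) ?implybT// powRr1 ?(ltW t0)//.
by rewrite /GRing.scale/=; ring.
Unshelve. all: by end_near. Qed.

Lemma is_derive_spow (z : R) : is_derive z 1 spow (`|z| `^ a).
Proof.
have [z0|z0|->] := ltrgt0P z.
- by have := is_derive_spow_gt0 z0; rewrite gtr0_norm.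
- have nz : 0 < - z by rewrite oppr_gt0.
  have h := is_derive_spow_gt0 nz; rewrite gtr0_norm// in h.
  have -> : spow = - (spow \o (-%R : R -> R)).
    by apply/funext => t; rewrite /= !fctE/= spowN opprK.
  have h2 : is_derive z 1 (-%R : R -> R) (-1) by apply: is_deriveNid.
  have h3 := is_derive1_comp h h2.
  by apply: is_derive_eq; rewrite mulrN1 opprK.
- rewrite powR0 ?gt_eqF//.
  (* At 0 the difference quotient is [|h|^a / (1 + a)]. *)
  have cv : h^-1 *: (spow (h *: 1 + 0) - spow 0) @[h --> (0 : R)^'] --> (0 : R).
    have c1 : `|h| `^ a / (1 + a) @[h --> (0 : R)^'] --> (0 : R).
      rewrite -[X in _ --> X](mul0r (1 + a)^-1); apply: cvgM; last exact: cvg_cst.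
      have := @abs_powR_continuous 0; rewrite /continuous_at normr0 powR0 ?gt_eqF// => c0.
      by apply: cvg_within_filter.
    apply: cvg_trans c1; apply: near_eq_cvg; near=> h.
    have h0 : h != 0 by near: h; exact: nbhs_dnbhs_neq.
    rewrite /spow /GRing.scale/= mulr1 addr0 !mul0r subr0 !mulrA mulVf// mul1r//.
  apply: DeriveDef; first by apply/cvg_ex; exists 0; exact: cv.
  exact: cvg_lim cv.
Unshelve. all: by end_near. Qed.

Lemma measurable_spow : measurable_fun setT spow.
Proof. by rewrite /spow; meas; exact: measurable_cst. Qed.

Definition spow2 (z h : R) : R := 2 * spow z - spow (z + h) - spow (z - h).

Lemma spow2N z h : spow2 (- z) h = - spow2 z h.
Proof.
rewrite /spow2 (_ : - z + h = - (z - h)); last by ring.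
by rewrite (_ : - z - h = - (z + h)) ?spowN; ring.
Qed.

Lemma spow20 h : spow2 0 h = 0.
Proof. by rewrite /spow2 add0r sub0r spowN {1}/spow !mul0r; ring. Qed.

Lemma spow2M b z h : 0 < b -> spow2 (b * z) (b * h) = b `^ (1 + a) * spow2 z h.
Proof.
move=> b0; have sM t : spow (b * t) = b `^ (1 + a) * spow t.
  rewrite /spow normrM powRM// gtr0_norm// powRD ?(gt_eqF b0) ?implybT// powRr1 ?(ltW b0)//.
  ring.
by rewrite /spow2 -mulrDr -mulrBr !sM; ring.
Qed.

Let spow2_1_derive (t : R) : is_derive t 1 (spow2 1) (`|1 - t| `^ a - `|1 + t| `^ a).
Proof.
have d1 : is_derive t 1 (cst 1 + id : R -> R) 1 by apply: is_derive_eq; rewrite add0r.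
have d2 : is_derive t 1 (cst 1 - id : R -> R) (-1) by apply: is_derive_eq; rewrite sub0r.
have h1 := @is_derive1_comp _ spow (cst 1 + id) t _ _ (is_derive_spow (1 + t)) d1.
have h2 := @is_derive1_comp _ spow (cst 1 - id) t _ _ (is_derive_spow (1 - t)) d2.
have -> : spow2 1 = cst (2 * spow 1) - (spow \o (cst 1 + id : R -> R)) - (spow \o (cst 1 - id : R -> R)).
  by apply/funext => u; rewrite /spow2 !fctE.
by apply: is_derive_eq; rewrite mulr1 mulrN1; ring.
Qed.

Let spow2_10 : spow2 1 0 = 0.
Proof. by rewrite /spow2 addr0 subr0; ring. Qed.

Let spow2_1_mvt h : 0 < h -> exists2 c, 0 < c < h &
  spow2 1 h = (`|1 - c| `^ a - `|1 + c| `^ a) * h.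
Proof.
move=> h0.
have cont : {within `[0, h], continuous (spow2 1)}.
  apply: derivable_within_continuous => t _.
  exact: (@ex_derive _ _ _ _ _ _ _ (spow2_1_derive t)).
have [c] := MVT h0 (fun t _ => spow2_1_derive t) cont.
rewrite in_itv/= => c0h; rewrite spow2_10 !subr0 => E.
by exists c.
Qed.

(** The derivative in [h] is [|1 - h|^a - |1 + h|^a], negative for every [h > 0]. *)
Lemma spow2_1_lt0 h : 0 < h -> spow2 1 h < 0.
Proof.
move=> h0; have [c /andP[c0 ch] ->] := spow2_1_mvt h0.
rewrite nmulr_rlt0// subr_lt0; apply: gt0_ltr_powR; rewrite ?nnegrE//.
by rewrite (@ger0_norm _ (1 + c)) ?addr_ge0 ?(ltW c0)// ltr_norml; apply/andP; split; lra.
Qed.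

(** Since [1 - c <= (1 - c)^a] and [(1 + c)^a <= 1 + c], the derivative is at most [2 c] in size.
    This avoids a second derivative of [spow], which is singular at the point reached when
    [h = 1]. *)
Lemma spow2_1_near0 h : 0 < h -> h <= 1 -> `|spow2 1 h| <= 4 * h `^ 2.
Proof.
move=> h0 h1; rewrite ltr0_norm ?spow2_1_lt0//.
have [c /andP[c0 ch] ->] := spow2_1_mvt h0.
rewrite powR_mulrn ?(ltW h0)// -mulNr expr2 mulrA ler_pM2r// opprB.
rewrite !ger0_norm; [|lra|lra].
have := @ler1_powR _ (1 + c) a; have := @ger1_powR _ (1 - c) a.
move=> /(_ _ (ltW a1)) e1 /(_ _ (ltW a1)) e2.
have {}e1 : 1 - c <= (1 - c) `^ a by apply: e1; apply/andP; split; lra.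
have {}e2 : (1 + c) `^ a <= 1 + c by apply: e2; lra.
lra.
Qed.

(** By oddness the two far terms form [spow (h + 1) - spow (h - 1)], an increment over an interval
    of length 2, so the growth is [h^a] and not [h^(1 + a)]. *)
Lemma spow2_1_infty h : 1 < h -> `|spow2 1 h| <= 4 * h `^ a.
Proof.
move=> h1; have h0 := lt_trans ltr01 h1; rewrite ltr0_norm ?spow2_1_lt0//.
have cont : {within `[h - 1, h + 1], continuous spow}.
  apply: derivable_within_continuous => t _.
  exact: (@ex_derive _ _ _ _ _ _ _ (is_derive_spow t)).
have hh : h - 1 < h + 1 by lra.
have [c] := MVT hh (fun t _ => is_derive_spow t) cont.
rewrite in_itv/= => /andP[c1 c2] E.
have -> : - spow2 1 h = (spow (h + 1) - spow (h - 1)) - 2 * spow 1.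
  by rewrite /spow2 (addrC 1) -(opprB h) spowN; ring.
have s1 : 0 <= spow 1 by rewrite /spow normr1 divr_ge0 ?mulr_ge0 ?powR_ge0 ?addr_ge0 ?(ltW a0).
rewrite E (_ : h + 1 - (h - 1) = 2); last by ring.
have : `|c| `^ a <= 2 `^ a * h `^ a.
  rewrite -powRM ?(ltW h0)//; apply: ge0_ler_powR; rewrite ?nnegrE ?(ltW a0) ?mulr_ge0 ?(ltW h0)//.
  by rewrite ger0_norm; lra.
have : 2 `^ a * h `^ a <= 2 * h `^ a.
  by rewrite ler_wpM2r ?powR_ge0// -[leRHS](@powRr1 _ 2)// ler_powR ?(ltW a1)// ler1n.
by lra.
Qed.

(* With a = 2 s - 1 this is the kernel h^-(1 + 2 s) of the fractional Laplacian. *)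
Definition hker (h : R) : R := if 0 < h then h `^ (- (2 + a)) else 0.

Lemma hker_ge0 h : 0 <= hker h.
Proof. by rewrite /hker; case: ifPn => // _; exact: powR_ge0. Qed.

Lemma measurable_hker : measurable_fun setT hker.
Proof. by apply: measurable_fun_ifT => //; exact: measurable_fun_ltr. Qed.

(* The common shape of the Fubini dominations: O(h^2) at 0 and O(h^a) at infinity
   against the kernel h^-(2 + a). *)
Lemma intble_hker (f : R -> R) (c : R) : measurable_fun setT f ->
  (forall h, 0 < h -> h <= 1 -> `|f h| <= c * h `^ 2) ->
  (forall h, 1 < h -> `|f h| <= c * h `^ a) ->
  intble mu (fun h => hker h * f h).
Proof.
move=> mf f1 f2; apply: (@intble_le_powR R a 2 c) => //.
- by rewrite ltr1n.
- by apply: measurable_funM => //; exact: measurable_hker.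
- by move=> h h0; rewrite /hker ltNge h0/= mul0r.
- move=> h h0 h1; rewrite /hker h0 normrM (ger0_norm (powR_ge0 _ _)).
  rewrite (_ : - a = - (2 + a) + 2); last by ring.
  rewrite powRD ?(gt_eqF h0) ?implybT// mulrCA ler_wpM2l ?powR_ge0//.
  exact: f1.
- move=> h h1; have h0 := lt_trans ltr01 h1.
  rewrite /hker h0 normrM (ger0_norm (powR_ge0 _ _)).
  rewrite (_ : - 2 = - (2 + a) + a); last by ring.
  rewrite powRD ?(gt_eqF h0) ?implybT// mulrCA ler_wpM2l ?powR_ge0//.
  exact: f2.
Qed.

(** Twice this number is the coefficient of the Dirac mass in [Rint_kernel_flap]; its sign decides
    that [lam] is positive. *)
Definition riesz_cst : R := \Rint[mu]_h (hker h * spow2 1 h).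

Let measurable_spow2 z : measurable_fun setT (spow2 z).
Proof.
have m := measurable_spow; rewrite /spow2; apply: measurable_funB; first apply: measurable_funB => //.
- by apply: (measurableT_comp m); meas.
- by apply: (measurableT_comp m); meas.
Qed.

Let intble_spow2_1 : intble mu (fun h => hker h * spow2 1 h).
Proof. by apply: intble_hker; [|exact: spow2_1_near0|exact: spow2_1_infty]. Qed.

Lemma riesz_cst_lt0 : riesz_cst < 0.
Proof.
rewrite -oppr_gt0 /riesz_cst -RintN//.
apply: (@Rint_gt0 _ _ 0 1) => //; first exact: intbleN.
- move=> h; have [h0|h0] := leP h 0; first by rewrite /hker ltNge h0/= mul0r oppr0.
  by rewrite -mulrN mulr_ge0 ?hker_ge0// oppr_ge0 ltW// spow2_1_lt0.
- move=> h h0 _; rewrite -mulrN mulr_gt0//; first by rewrite /hker h0 powR_gt0.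
  by rewrite oppr_gt0 spow2_1_lt0.
Qed.

(** The degrees [1 + a] and [-(2 + a)] leave [z^-1], which the Jacobian cancels: the integral over
    [h] is the same for every [z > 0]. *)
Let hker_scale z h : 0 < z -> hker h * spow2 z h = z^-1 * (hker (z^-1 * h) * spow2 1 (z^-1 * h)).
Proof.
move=> z0; have zi : 0 < z^-1 by rewrite invr_gt0.
have -> : spow2 z h = z `^ (1 + a) * spow2 1 (z^-1 * h).
  by rewrite -spow2M// mulr1 mulrA divff ?mul1r// gt_eqF.
rewrite /hker pmulr_rgt0//; case: ltP => h0; last by rewrite !mul0r mulr0.
rewrite powRM ?(ltW zi) ?(ltW h0)//.
have -> : z^-1 `^ (- (2 + a)) = z * z `^ (1 + a).
  rewrite -[X in X * _](powRr1 (ltW z0)) -powRD ?(gt_eqF z0) ?implybT//.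
  rewrite -(powR_inv1 (ltW z0)) -powRrM; congr (_ `^ _); ring.
by rewrite !mulrA mulVf ?gt_eqF// mul1r; ring.
Qed.

Lemma hker_spow2 z :
  intble mu (fun h => hker h * spow2 z h) /\
  \Rint[mu]_h (hker h * spow2 z h) = Num.sg z * riesz_cst.
Proof.
have pos t : 0 < t -> intble mu (fun h => hker h * spow2 t h) /\
    \Rint[mu]_h (hker h * spow2 t h) = riesz_cst.
  move=> t0; have ti : t^-1 != 0 by rewrite invr_eq0 gt_eqF.
  have i1 := @intble_scale _ (fun h => hker h * spow2 1 h) _ ti intble_spow2_1.
  split.
    apply: (@eq_intble _ _ _ mu _ _ (fun h => esym (@hker_scale t h t0))).
    exact: intbleZl.
  rewrite (eq_Rint mu (fun h => @hker_scale t h t0)) RintZl//.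
  rewrite (@Rint_scale _ (fun h => hker h * spow2 1 h))// gtr0_norm ?invr_gt0// invrK.
  by rewrite mulrA mulVf ?mul1r// gt_eqF.
have [z0|z0|->] := ltrgt0P z.
- by have [i e] := pos z z0; rewrite gtr0_sg// mul1r.
- have nz : 0 < - z by rewrite oppr_gt0.
  have [i e] := pos _ nz; rewrite ltr0_sg// mulN1r.
  have E h : - (hker h * spow2 (- z) h) = hker h * spow2 z h.
    by rewrite spow2N mulrN opprK.
  split; first by apply: (@eq_intble _ _ _ mu _ _ E); exact: intbleN.
  by rewrite -e -RintN//; apply: eq_Rint => h; rewrite E.
- have E h : 0 = hker h * spow2 0 h by rewrite spow20 mulr0.
  split; first by apply: (@eq_intble _ _ _ mu _ _ E); exact: intble0.
  by rewrite -(eq_Rint mu E) RintE integral0 sgr0 mul0r.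
Qed.

(** For fixed [z] the integrand has constant sign, so its norm is again the constant. Being uniform
    in [z], the bound lets [dphi] alone dominate in Fubini. *)
Lemma hker_spow2_norm z :
  \Rint[mu]_h `|hker h * spow2 z h| <= - riesz_cst.
Proof.
have sgn h : `|hker h * spow2 z h| = - (Num.sg z * (hker h * spow2 z h)).
  have [h0|h0] := leP h 0; first by rewrite /hker ltNge h0/= mul0r normr0 mulr0 oppr0.
  have neg t : 0 < t -> spow2 t h < 0.
    move=> t0; rewrite (_ : spow2 t h = t `^ (1 + a) * spow2 1 (t^-1 * h)).
      by rewrite pmulr_rlt0 ?powR_gt0// spow2_1_lt0// mulr_gt0// invr_gt0.
    by rewrite -spow2M// mulr1 mulrA divff ?mul1r// gt_eqF.
  rewrite normrM (ger0_norm (hker_ge0 _)).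
  have [z0|z0|->] := ltrgt0P z.
  - by rewrite ltr0_norm ?neg// gtr0_sg// mul1r mulrN.
  - have nz : 0 < - z by rewrite oppr_gt0.
    have := neg _ nz; rewrite spow2N oppr_lt0 => p.
    by rewrite gtr0_norm// ltr0_sg// mulN1r opprK.
  - by rewrite spow20 normr0 !mulr0 oppr0.
have [i e] := hker_spow2 z.
rewrite (eq_Rint mu sgn) RintN; last exact: intbleZl.
rewrite RintZl// e mulrA lerNl opprK.
have := riesz_cst_lt0; have [z0|z0|->] := ltrgt0P z.
- by rewrite gtr0_sg// !mul1r.
- by rewrite ltr0_sg// mulrNN !mul1r.
- by rewrite sgr0 !mul0r => /ltW.
Qed.

End signed_power.

(** * Quantitative properties of test functions *)

Section test_functions.
Context (R : realType).
Notation mu := (@lebesgue_measure R).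
Implicit Types (f phi : R -> R).

Lemma derive1_outside f (B : R) : (forall x, B < `|x| -> f x = 0) ->
  forall x, B < `|x| -> derive1 f x = 0.
Proof.
move=> fB x Bx; rewrite derive1E -(derive_cst (0 : R) x 1).
apply: near_eq_derive; near=> y; rewrite fB//.
near: y; have : `|y| @[y --> x] --> `|x| by apply: cvg_norm; exact: cvg_id.
by move=> /cvgr_gt; apply.
Unshelve. all: by end_near. Qed.

(** The only properties of test functions used below; the Lipschitz constant is the maximum of the
    second derivative on the support interval. *)
Lemma test_function_props phi : test_function phi ->
  exists (dphi : R -> R) (A M : R), [/\ 0 < A,
    (forall x : R, is_derive x 1 phi (dphi x)),
    (forall x, A <= `|x| -> phi x = 0 /\ dphi x = 0) &
    (forall x y, `|dphi x - dphi y| <= M * `|x - y|)].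
Proof.
move=> [dphi cphi].
have [B phiB] : exists B, forall x, B < `|x| -> phi x = 0.
  have [B [_ HB]] := compact_bounded cphi.
  exists (B + 1) => x Bx; apply: contrapT => /eqP px.
  have /(_ _ x) := HB (B + 1); rewrite ltrDl => /(_ ltr01).
  move=> /(_ (@subset_closure _ [set x : R | phi x != 0] x px)) /=.
  by rewrite leNgt Bx.
have d1B := derive1_outside phiB.
have d2B := derive1_outside d1B.
have dp (x : R) : derivable phi x 1 by exact: (dphi 0%N).
have dp1 (x : R) : derivable (derive1 phi) x 1 by exact: (dphi 1%N).
have cdd : continuous (derive1 (derive1 phi)).
  by move=> x; apply/differentiable_continuous/derivable1_diffP; exact: (dphi 2%N).
pose A := `|B| + 1.
have AB x : A <= `|x| -> B < `|x|.
  by move=> Ax; apply: lt_le_trans Ax; rewrite /A; have := ler_norm B; lra.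
have A0 : 0 < A by rewrite /A ltr_wpDl.
have [M HM] : exists M, forall x, `|derive1 (derive1 phi) x| <= M.
  have AA : - A <= A by lra.
  have [|c _ cmax] := @EVT_max R (fun x => `|derive1 (derive1 phi) x|) (- A) A AA.
    apply: continuous_subspaceT => x; apply: continuous_comp; first exact: cdd.
    exact: norm_continuous.
  exists `|derive1 (derive1 phi) c| => x.
  have [xA|xA] := leP `|x| A; first by apply: cmax; rewrite in_itv/= -ler_norml.
  by rewrite d2B ?normr0//; apply: AB; exact: ltW.
exists (derive1 phi), A, M; split => //.
- by move=> x; apply: DeriveDef => //; rewrite derive1E.
- by move=> x /AB Bx; rewrite phiB ?d1B.
- have lip x y : x < y -> `|derive1 phi x - derive1 phi y| <= M * `|x - y|.
    move=> xy; have dd (z : R) : is_derive z 1 (derive1 phi) (derive1 (derive1 phi) z).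
      by have := DeriveDef (dp1 z) (esym (derive1E (derive1 phi) z)).
    have cont : {within `[x, y], continuous (derive1 phi)}.
      exact: derivable_within_continuous.
    have [c _ E] := MVT xy (fun z _ => dd z) cont.
    by rewrite distrC E normrM (distrC x) ler_wpM2r.
  move=> x y; have [xy|yx|->] := ltgtP x y.
  + exact: lip.
  + by rewrite distrC (distrC x); exact: lip.
  + by rewrite !subrr normr0 mulr0.
Qed.

End test_functions.

Section compact_support.
Context (R : realType).
Notation mu := (@lebesgue_measure R).

Lemma compact_support_bound (f : R -> R) (A C : R) : 0 < A -> 0 <= C -> measurable_fun setT f ->
  (forall x, A <= `|x| -> f x = 0) -> (forall x, `|x| <= A -> `|f x| <= C) ->
  intble mu f /\ \Rint[mu]_x `|f x| <= 2 * A * C.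
Proof.
move=> A0 C0 mf f0 fC.
have i1 : intble mu (\1_(`[- A, A]) : R -> R).
  by split; exact: (integrable_indic_itv (- A) A true false).
have dom x : `|f x| <= C * \1_(`[- A, A]) x.
  rewrite indicE mem_setE in_itv/= -ler_norml; case: (leP `|x| A) => xA; first by rewrite mulr1; exact: fC.
  by rewrite f0 ?normr0 ?mulr0// ltW.
have i2 : intble mu f by apply: (@le_intbleR _ _ (fun x => C * \1_(`[- A, A]) x)) => //; exact: intbleZl.
split => //; apply: le_trans (le_Rint (intble_norm i2) (intbleZl C i1) dom) _.
rewrite RintZl// RintE integral_indic// setIT.
have /= := lebesgue_measure_itv `[- A, A]; rewrite lte_fin ifT; last by lra.
by move=> ->; rewrite -EFinD/=; lra.
Qed.

End compact_support.

(** * Duality for the integral of second differences *)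

Section fractional_laplacian.
Context (R : realType).
Notation mu := (@lebesgue_measure R).
Variable a : R.
Hypothesis a01 : 0 < a < 1.
Variables (phi dphi : R -> R) (A M : R).
Hypothesis A0 : 0 < A.
Hypothesis dphiP : forall x : R, is_derive x 1 phi (dphi x).
Hypothesis supp : forall x, A <= `|x| -> phi x = 0 /\ dphi x = 0.
Hypothesis lip : forall x y, `|dphi x - dphi y| <= M * `|x - y|.

Let a0 : 0 < a. Proof. by case/andP: a01. Qed.
Let a01' : 0 < a <= 1. Proof. by case/andP: a01 => -> /ltW. Qed.

Let M0 : 0 <= M.
Proof.
have := lip 1 0; rewrite subr0 normr1 mulr1; exact: le_trans.
Qed.

Let cphi : continuous phi.
Proof.
by move=> x; apply/differentiable_continuous/derivable1_diffP; exact: ex_derive.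
Qed.

Lemma dphi_continuous : continuous dphi.
Proof.
move=> x; apply/cvgrPdist_lt => e e0; near=> y.
apply: le_lt_trans (lip x y) _.
apply: (@le_lt_trans _ _ ((M + 1) * `|x - y|)); first by rewrite ler_wpM2r// lerDl.
rewrite mulrC -ltr_pdivlMr ?ltr_wpDl//.
near: y; apply: cvgr_dist_lt; [exact: cvg_id|by rewrite divr_gt0// ltr_wpDl].
Unshelve. all: by end_near. Qed.

Let cdphi : continuous dphi := dphi_continuous.

Let mphi : measurable_fun setT phi. Proof. exact: continuous_measurable_fun. Qed.

Let bounded (f : R -> R) : continuous f -> (forall x, A <= `|x| -> f x = 0) ->
  exists2 B : R, 0 <= B & forall x, `|f x| <= B.
Proof.
move=> cf f0; have AA : - A <= A by have := A0; lra.
have [|c _ cmax] := @EVT_max R (fun x => `|f x|) (- A) A AA.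
  apply: continuous_subspaceT => x; apply: continuous_comp; first exact: cf.
  exact: norm_continuous.
exists `|f c| => // x; have [xA|xA] := leP `|x| A; first by apply: cmax; rewrite in_itv/= -ler_norml.
by rewrite f0 ?normr0// ltW.
Qed.

Lemma intble_compact_support (f : R -> R) : continuous f ->
  (forall x, A <= `|x| -> f x = 0) -> intble mu f.
Proof.
move=> cf f0; have [B B0 HB] := bounded cf f0.
have mf : measurable_fun setT f by exact: continuous_measurable_fun.
by have [] := compact_support_bound A0 B0 mf f0 (fun x _ => HB x).
Qed.

Lemma phi_bounded : exists2 B : R, 0 <= B & forall x, `|phi x| <= B.
Proof. by apply: bounded => // x xA; have [] := supp xA. Qed.

Lemma intble_dphi : intble mu dphi.
Proof. by apply: intble_compact_support => // x xA; have [] := supp xA. Qed.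

Definition diff2 (x h : R) : R := 2 * phi x - phi (x + h) - phi (x - h).
(* The fractional Laplacian without its constant, the principal value being replaced
   by an absolutely convergent integral of second differences. *)
Definition flap (x : R) : R := \Rint[mu]_h (hker a h * diff2 x h).

(** The derivative in [h] is [dphi (x - h) - dphi (x + h)], at most [2 M h] in size. *)
Lemma diff2_le (x h : R) : 0 < h -> `|diff2 x h| <= (2 * M) * h `^ 2.
Proof.
move=> h0.
have dd (t : R) : is_derive t 1 (diff2 x) (dphi (x - t) - dphi (x + t)).
  have d1 : is_derive t 1 (cst x + id : R -> R) 1 by apply: is_derive_eq; rewrite add0r.
  have d2 : is_derive t 1 (cst x - id : R -> R) (-1) by apply: is_derive_eq; rewrite sub0r.
  have h1 := @is_derive1_comp _ phi (cst x + id) t _ _ (dphiP (x + t)) d1.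
  have h2 := @is_derive1_comp _ phi (cst x - id) t _ _ (dphiP (x - t)) d2.
  have -> : diff2 x = cst (2 * phi x) - (phi \o (cst x + id : R -> R)) - (phi \o (cst x - id : R -> R)).
    by apply/funext => u; rewrite /diff2 !fctE.
  by apply: is_derive_eq; rewrite mulr1 mulrN1; ring.
have cont : {within `[0, h], continuous (diff2 x)}.
  by apply: derivable_within_continuous => t _; exact: (@ex_derive _ _ _ _ _ _ _ (dd t)).
have [c] := MVT h0 (fun t _ => dd t) cont.
rewrite in_itv/= => /andP[c0 ch]; rewrite {2}/diff2 addr0 subr0 (_ : 2 * phi x - _ - _ = 0); last by ring.
rewrite !subr0 => ->; rewrite normrM (gtr0_norm h0) powR_mulrn ?(ltW h0)// expr2 mulrA.
rewrite ler_pM2r//; apply: le_trans (lip _ _) _.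
rewrite (_ : x - c - (x + c) = - (2 * c)); last by ring.
by rewrite normrN gtr0_norm ?mulr_gt0//; have := ler_wpM2l M0 (ltW ch); lra.
Qed.

Lemma diff2_0 x h : 0 < h -> h <= 1 -> A + 1 <= `|x| -> diff2 x h = 0.
Proof.
move=> h0 h1 xA.
have z t : `|t| <= 1 -> phi (x + t) = 0.
  move=> t1; have [] := @supp (x + t) => //.
  by have := lerB_normD x t; lra.
rewrite /diff2 -{1}(addr0 x) !z ?normr0 ?normrN ?(gtr0_norm h0)//; ring.
Qed.

Lemma measurable_diff2 : measurable_fun setT (fun z : R * R => diff2 z.2 z.1).
Proof.
apply: measurable_funB; first apply: measurable_funB.
- by apply: measurable_funM => //; exact: (measurableT_comp mphi measurable_snd).
- by apply: (measurableT_comp mphi); meas.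
- by apply: (measurableT_comp mphi); meas.
Qed.

Lemma intble_hker_diff2 x : intble mu (fun h => hker a h * diff2 x h).
Proof.
have [B B0 HB] := bounded cphi (fun x xA => (supp xA).1).
apply: (@intble_hker _ _ a01 _ (2 * M + 4 * B)).
- exact: (@measurable_section2 _ _ _ _ _ (fun h x => diff2 x h) measurable_diff2 x).
- move=> h h0 h1; apply: le_trans (diff2_le x h0) _.
  by rewrite ler_wpM2r ?powR_ge0// lerDl mulr_ge0.
- move=> h h1; apply: (@le_trans _ _ (4 * B)).
    rewrite /diff2; apply: le_trans (ler_normB _ _) _.
    apply: (@le_trans _ _ (`|2 * phi x| + `|phi (x + h)| + `|phi (x - h)|)).
      by rewrite lerD2r ler_normB.
    by rewrite normrM ger0_norm//; have := HB x; have := HB (x + h); have := HB (x - h); lra.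
  apply: (@le_trans _ _ (2 * M + 4 * B)); first by rewrite lerDr mulr_ge0.
  rewrite ler_peMr ?addr_ge0 ?mulr_ge0//.
  by rewrite -(powRr0 h) ler_powR ?(ltW a0) ?(ltW h1).
Qed.

Section pairing.
Variables (w : R -> R) (c : R).
Hypothesis mw : measurable_fun setT w.
Hypothesis c0 : 0 <= c.
Hypothesis wc : forall x, `|w x| <= c * (1 + `|x| `^ a).

(** The shift is arranged so that [wp k (x + k)] is [w x * phi (x + k)], a term of the second
    difference. *)
Let wp (k x : R) := w (x - k) * phi x.

(** The growth [1 + |k|^a] is what [hker] can absorb at infinity. *)
Let wp_bound : exists2 B : R, 0 <= B & forall k, intble mu (wp k) /\
  \Rint[mu]_x `|wp k x| <= B * (1 + `|k| `^ a).
Proof.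
have [B B0 HB] := bounded cphi (fun x xA => (supp xA).1).
exists (2 * A * (c * (1 + A `^ a) * B)).
  by rewrite !mulr_ge0// ?addr_ge0 ?powR_ge0// ltW.
move=> k; set C := c * (1 + A `^ a) * B * (1 + `|k| `^ a).
have C0 : 0 <= C by rewrite !mulr_ge0// ?addr_ge0 ?powR_ge0.
have mwp : measurable_fun setT (wp k).
  by apply: measurable_funM => //; apply: (measurableT_comp mw); meas.
have [||i b] := @compact_support_bound _ (wp k) A C A0 C0 mwp.
- by move=> x xA; rewrite /wp (supp xA).1 mulr0.
- move=> x xA; rewrite /wp normrM /C mulrAC; apply: ler_pM => //.
  apply: le_trans (wc _) _; rewrite -mulrA ler_wpM2l//.
  have h1 : `|x - k| `^ a <= `|x| `^ a + `|k| `^ a.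
    by rewrite -(normrN k) abs_powR_subadditive.
  have h2 : `|x| `^ a <= A `^ a.
    by apply: ge0_ler_powR; rewrite ?nnegrE ?(ltW a0) ?(ltW A0).
  have := powR_ge0 A a; have := powR_ge0 `|k| a; nra.
- by split => //; apply: le_trans b _; rewrite /C !mulrA.
Qed.

Let wD h x := w x * diff2 x h.

Let wDE h x : wD h x = 2 * wp 0 x - wp h (x + h) - wp (- h) (x + (- h)).
Proof. by rewrite /wD /wp /diff2 subr0 addrK opprK subrK; ring. Qed.

Let intble_wD h : intble mu (wD h).
Proof.
have [B B0 HB] := wp_bound.
apply: (@eq_intble _ _ _ mu _ _ (fun x => esym (wDE h x))).
apply: intbleB; first apply: intbleB.
- by apply: intbleZl; have [] := HB 0.
- by apply: (@intble_shift _ (wp h)); have [] := HB h.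
- by apply: (@intble_shift _ (wp (- h))); have [] := HB (- h).
Qed.

Let Rint_wD h : \Rint[mu]_x wD h x =
  \Rint[mu]_x (phi x * (2 * w x - w (x + h) - w (x - h))).
Proof.
have [B B0 HB] := wp_bound.
have [i0 _] := HB 0; have [i1 _] := HB h; have [i2 _] := HB (- h).
have j1 := @intble_shift _ (wp h) h i1; have j2 := @intble_shift _ (wp (- h)) (- h) i2.
have j0 := intbleZl 2 i0.
rewrite (eq_Rint mu (wDE h)) RintB//; last exact: intbleB.
rewrite RintB// (@Rint_shift _ (wp h))// (@Rint_shift _ (wp (- h)))//.
rewrite -RintB// -RintB//; last exact: intbleB.
by apply: eq_Rint => x; rewrite /wp subr0 opprK; ring.
Qed.

Let measurable_wD : measurable_fun setT (fun z : R * R => wD z.1 z.2).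
Proof.
apply: measurable_funM; last exact: measurable_diff2.
exact: (measurableT_comp mw measurable_snd).
Qed.

Let norm_wD h : \Rint[mu]_x `|wD h x| = `|\Rint[mu]_x `|wD h x| |.
Proof. by rewrite ger0_norm// Rint_ge0. Qed.

Lemma Rint_mul_flap : intble mu (fun x => w x * flap x) /\
  \Rint[mu]_x (w x * flap x) =
  \Rint[mu]_h (hker a h * \Rint[mu]_x (phi x * (2 * w x - w (x + h) - w (x - h)))).
Proof.
have [B B0 HB] := wp_bound.
pose F h x := hker a h * wD h x.
have mF : measurable_fun setT (fun z : R * R => F z.1 z.2).
  apply: measurable_funM => //; exact: (measurableT_comp (measurable_hker a) measurable_fst).
(* For [h <= 1] the second difference is supported in [[-(A + 1), A + 1]] and is [O(h^2)]. *)
pose C1 := 2 * (A + 1) * (c * (1 + (A + 1) `^ a) * (2 * M)).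
have C10 : 0 <= C1 by rewrite !mulr_ge0// ?addr_ge0 ?powR_ge0// ltW.
(* For [h > 1] the three terms are bounded separately, by [2 B] and twice [B (1 + h^a)], in total at
   most [6 B h^a]. *)
pose C2 := 8 * B.
have C20 : 0 <= C2 by rewrite mulr_ge0.
have A10 : 0 < A + 1 by rewrite addr_gt0.
have [||h|i1 i2 E] := @Fubini_R _ F (fun h => hker a h * \Rint[mu]_x `|wD h x|) mF.
- by move=> h; exact: intbleZl.
- apply: (@intble_hker _ _ a01 _ (C1 + C2)).
  + apply: measurable_RintR; first exact: measurable_fun_norm.
    by move=> h; exact: intble_norm.
  + move=> h h0 h1; rewrite -norm_wD mulrDl.
    apply: (@le_trans _ _ (C1 * h `^ 2)); last by rewrite lerDl mulr_ge0 ?powR_ge0.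
    pose C := c * (1 + (A + 1) `^ a) * (2 * M) * h `^ 2.
    have C0 : 0 <= C by rewrite !mulr_ge0// ?addr_ge0 ?powR_ge0.
    have [||_] := @compact_support_bound _ (wD h) (A + 1) C A10 C0 (intble_measurable (intble_wD h)).
    * by move=> x xA; rewrite /wD diff2_0 ?mulr0.
    * move=> x xA; rewrite /wD normrM /C -mulrA; apply: ler_pM => //; last exact: diff2_le.
      apply: le_trans (wc x) _; rewrite ler_wpM2l// lerD2l.
      by apply: ge0_ler_powR; rewrite ?nnegrE ?(ltW a0) ?(ltW A10).
    * by rewrite /C /C1 !mulrA.
  + move=> h h1; have h0 := lt_trans ltr01 h1; rewrite -norm_wD.
    have ha : 1 <= h `^ a.
      by rewrite -(powRr0 h) ler_powR ?(ltW a0) ?(ltW h1).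
    apply: (@le_trans _ _ (C2 * h `^ a)); last by rewrite ler_wpM2r ?powR_ge0// lerDr.
    have [i0 b0] := HB 0; have [ii1 b1] := HB h; have [ii2 b2] := HB (- h).
    have j1 := @intble_shift _ (wp h) h ii1; have j2 := @intble_shift _ (wp (- h)) (- h) ii2.
    have n0 := intble_norm i0; have n1 := intble_norm j1; have n2 := intble_norm j2.
    apply: (@le_trans _ _ (\Rint[mu]_x (2 * `|wp 0 x| + `|wp h (x + h)| + `|wp (- h) (x + - h)|))).
      apply: le_Rint; first exact: intble_norm.
        by apply: intbleD => //; apply: intbleD => //; exact: intbleZl.
      move=> x; rewrite wDE; apply: le_trans (ler_normB _ _) _.
      rewrite lerD2r; apply: le_trans (ler_normB _ _) _.
      by rewrite lerD2r normrM ger0_norm.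
    rewrite RintD//; last by apply: intbleD => //; exact: intbleZl.
    rewrite RintD//; last exact: intbleZl.
    rewrite RintZl// (@Rint_shift _ (fun x => `|wp h x|))//; last exact: intble_norm.
    rewrite (@Rint_shift _ (fun x => `|wp (- h) x|))//; last exact: intble_norm.
    move: b0 b1 b2; rewrite normrN normr0 powR0 ?gt_eqF// (gtr0_norm h0) addr0 mulr1.
    by rewrite /C2; nra.
- rewrite (@eq_Rint _ _ _ mu _ (fun x => hker a h * `|wD h x|)) ?RintZl//.
    exact: intble_norm.
  by move=> x; rewrite /F normrM ger0_norm// hker_ge0.
- have E1 x : \Rint[mu]_h F h x = w x * flap x.
    rewrite -RintZl; last exact: intble_hker_diff2.
    by apply: eq_Rint => h; rewrite /F /wD; ring.
  have E2 h : \Rint[mu]_x F h x =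
      hker a h * \Rint[mu]_x (phi x * (2 * w x - w (x + h) - w (x - h))).
    by rewrite RintZl// Rint_wD.
  split; first exact: (@eq_intble _ _ _ mu _ _ E1 i2).
  by rewrite -(eq_Rint mu E1) -E (eq_Rint mu E2).
Qed.

End pairing.

End fractional_laplacian.

(** * The principal value as an absolutely convergent integral *)

Section principal_value.
Context (R : realType).
Notation mu := (@lebesgue_measure R).
Variable s : R.
Hypothesis s01 : 2^-1 < s < 1.
Variables (phi dphi : R -> R) (A M : R).
Hypothesis A0 : 0 < A.
Hypothesis dphiP : forall x : R, is_derive x 1 phi (dphi x).
Hypothesis supp : forall x, A <= `|x| -> phi x = 0 /\ dphi x = 0.
Hypothesis lip : forall x y, `|dphi x - dphi y| <= M * `|x - y|.

Let a := 2 * s - 1.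
Let a01 : 0 < a < 1.
Proof. by case/andP: s01 => h1 h2; rewrite /a; apply/andP; split; lra. Qed.

Let hk (e h : R) : R := if e < h then h `^ (- (2 + a)) else 0.

Let measurable_hk e : measurable_fun setT (hk e).
Proof. by apply: measurable_fun_ifT => //; exact: measurable_fun_ltr. Qed.

Let intble_hk e : 0 < e -> intble mu (hk e).
Proof.
move=> e0; case/andP: a01 => a0 a1.
apply: (@intble_le_powR R 0 2 (1 + e `^ (- (2 + a)))) => //.
- by rewrite ltr1n.
- by move=> x x0; rewrite /hk ltNge (le_trans x0)// ltW.
- move=> x x0 _; rewrite oppr0 powRr0 mulr1 /hk; case: ifPn => ex.
    rewrite ger0_norm ?powR_ge0// (@le_trans _ _ (e `^ (- (2 + a))))// ?lerDr//.
    rewrite !powRN lef_pV2 ?posrE ?powR_gt0//; apply: ge0_ler_powR; rewrite ?nnegrE ?(ltW e0) ?(ltW x0) ?(ltW ex)//.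
    by rewrite addr_ge0// ltW.
  by rewrite normr0 addr_ge0// powR_ge0.
- move=> x x1; have x0 := lt_trans ltr01 x1.
  apply: (@le_trans _ _ (x `^ (- 2))); last by rewrite ler_peMl ?powR_ge0// lerDl powR_ge0.
  rewrite /hk; case: ifPn => ex; last by rewrite normr0 powR_ge0.
  by rewrite ger0_norm ?powR_ge0// ler_powR ?(ltW x1)// lerN2 lerDl ltW.
Qed.

Let mphi : measurable_fun setT phi.
Proof.
apply: continuous_measurable_fun => x.
by apply/differentiable_continuous/derivable1_diffP; exact: ex_derive.
Qed.

Lemma truncated_frac_laplacian x e : 0 < e ->
  Rintegral mu [set y : R | e < `|x - y|]
    (fun y => (phi x - phi y) / `|x - y| `^ (1 + 2 * s)) =
  \Rint[mu]_h (hk e h * diff2 phi x h).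
Proof.
move=> e0; have ih := intble_hk e0.
have [B B0 HB] : exists2 B : R, 0 <= B & forall x, `|phi x| <= B.
  by apply: phi_bounded dphiP supp.
(* [f1 (x - y)] is the part of the truncated integrand with [y < x] and [f2 (y - x)] the part with
   [y > x]; both are folded onto [h = |x - y|]. *)
pose f1 h := (phi x - phi (x - h)) * hk e h.
pose f2 h := (phi x - phi (h + x)) * hk e h.
have i1 : intble mu f1.
  apply: (@intbleMl _ _ _ mu _ _ (2 * B)) => //.
    by apply: measurable_funB => //; apply: (measurableT_comp mphi); meas.
  move=> h; apply: le_trans (ler_normB _ _) _.
  by have := HB x; have := HB (x - h); lra.
have i2 : intble mu f2.
  apply: (@intbleMl _ _ _ mu _ _ (2 * B)) => //.
    by apply: measurable_funB => //; apply: (measurableT_comp mphi); meas.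
  move=> h; apply: le_trans (ler_normB _ _) _.
  by have := HB x; have := HB (h + x); lra.
have -> : \Rint[mu]_h (hk e h * diff2 phi x h) = \Rint[mu]_y (f1 (x - y) + f2 (y - x)).
  rewrite RintD; [|exact: (@intble_reflect _ f1)|exact: (@intble_shift _ f2)].
  rewrite (@Rint_reflect _ f1)// (@Rint_shift _ f2)// -RintD//.
  by apply: eq_Rint => h; rewrite /f1 /f2 /diff2 (addrC h x); ring.
rewrite Rintegral_mkcond unlock; congr (Rintegral _ _ _); apply/funext => y.
rewrite patchE /f1 /f2 /hk subKr subrK -mulrDr.
have E : 1 + 2 * s = 2 + a by rewrite /a; ring.
rewrite E; case: ifPn => [/set_mem/=|/negP]; last first.
  rewrite inE/= => /negP; rewrite -leNgt => h.
  rewrite !ltNge (le_trans (ler_norm _) h) (le_trans (ler_norm _)) ?mulr0 ?addr0 ?mulr0//.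
  by rewrite distrC.
rewrite ltr_normr => /orP[h|h].
- rewrite h [e < y - x]ltNge (_ : y - x <= e); last by rewrite -opprB; lra.
  by rewrite addr0 powRN gtr0_norm// (lt_trans e0).
- rewrite opprB in h; rewrite h [e < x - y]ltNge (_ : x - y <= e); last by rewrite -opprB; lra.
  by rewrite add0r powRN distrC gtr0_norm// (lt_trans e0).
Qed.

Lemma frac_laplacianE x : frac_laplacian s phi x = frac_laplacian_cst s * flap a phi x.
Proof.
rewrite /frac_laplacian; congr (_ * _); apply: cvg_lim => //.
(* The limit is tested along sequences of radii, where dominated convergence applies with the
   untruncated integrand as bound. *)
apply/cvg_at_rightP => u [u0 u_cvg].
rewrite (_ : (fun n => _) = (fun n => \Rint[mu]_h (hk (u n) h * diff2 phi x h))); last first.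
  by apply/funext => n; rewrite truncated_frac_laplacian.
have i := intble_hker_diff2 a01 A0 dphiP supp lip x.
have md : measurable_fun setT (diff2 phi x).
  rewrite /diff2; apply: measurable_funB; first apply: measurable_funB => //.
  - by apply: (measurableT_comp mphi); meas.
  - by apply: (measurableT_comp mphi); meas.
apply: (Rint_dominated_cvgR (g := fun h => `|hker a h * diff2 phi x h|)).
- by move=> n; apply: measurable_funM.
- exact: intble_norm.
- move=> n h; rewrite !normrM ler_wpM2r// /hk /hker; case: ifPn => uh; last by rewrite normr0.
  by rewrite (lt_trans _ uh).
- move=> h; apply: cvgM; last exact: cvg_cst.
  have [h0|h0] := leP h 0.
    rewrite /hker ltNge h0/= (_ : (fun n => hk (u n) h) = fun=> 0); first exact: cvg_cst.
    by apply/funext => n; rewrite /hk ltNge (le_trans h0)// ltW.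
  have : (fun _ : nat => hker a h) @ \oo --> hker a h by exact: cvg_cst.
  apply: cvg_trans; apply: near_eq_cvg; near=> n.
  rewrite /hker /hk h0 ifT//; near: n.
  by move/cvgr_lt : u_cvg; apply.
Unshelve. all: by end_near. Qed.

End principal_value.

(** * The kernel as a fundamental solution *)

Section fundamental_solution.
Context (R : realType).
Notation mu := (@lebesgue_measure R).
Variable a : R.
Hypothesis a01 : 0 < a < 1.
Variables (phi dphi : R -> R) (A M : R).
Hypothesis A0 : 0 < A.
Hypothesis dphiP : forall x : R, is_derive x 1 phi (dphi x).
Hypothesis supp : forall x, A <= `|x| -> phi x = 0 /\ dphi x = 0.
Hypothesis lip : forall x y, `|dphi x - dphi y| <= M * `|x - y|.

Let a01' : 0 < a <= 1. Proof. by case/andP: a01 => -> /ltW. Qed.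

Let idphi : intble mu dphi := intble_dphi A0 supp lip.
Let mdphi : measurable_fun setT dphi := intble_measurable idphi.
Let cdphi : continuous dphi := dphi_continuous lip.

Let derive_cont (f df : R -> R) : (forall x : R, is_derive x 1 f (df x)) -> continuous f.
Proof.
move=> fP x; apply/differentiable_continuous/derivable1_diffP.
exact: (@ex_derive _ _ _ _ _ _ _ (fP x)).
Qed.

Let derive_oo (f df : R -> R) x y : (forall x : R, is_derive x 1 f (df x)) ->
  derivable_oo_LRcontinuous f x y /\ {in `]x, y[, derive1 f =1 df}.
Proof.
move=> fP; have cf := derive_cont fP; split; first split.
- by move=> z _; exact: (@ex_derive _ _ _ _ _ _ _ (fP z)).
- exact: (cvg_at_right_filter (cf x)).
- exact: (cvg_at_left_filter (cf y)).
- by move=> z _; rewrite derive1E; exact: (@derive_val _ _ _ _ _ _ _ (fP z)).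
Qed.

Let Rint_segment (f : R -> R) x y : (forall t, t \notin `[x, y] -> f t = 0) ->
  \Rint[mu]_t f t = Rintegral mu `[x, y] f.
Proof.
move=> f0; rewrite unlock [RHS]Rintegral_mkcond; congr (Rintegral _ _ _).
apply/funext => t; rewrite patchE; case: ifPn => //.
by rewrite mem_setE => /f0 ->.
Qed.

Lemma Rint_by_parts (F f : R -> R) : (forall x : R, is_derive x 1 F (f x)) -> continuous f ->
  \Rint[mu]_x (phi x * f x) = - \Rint[mu]_x (dphi x * F x).
Proof.
move=> FP cf.
have out t : t \notin `[- A, A] -> phi t = 0 /\ dphi t = 0.
  by rewrite in_itv/= -ler_norml -ltNge => /ltW; exact: supp.
rewrite (@Rint_segment _ (- A) A); last by move=> t /out[-> _]; rewrite mul0r.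
rewrite (@Rint_segment _ (- A) A); last by move=> t /out[_ ->]; rewrite mul0r.
have AA : - A < A by have := A0; lra.
have [d1 d2] := derive_oo (- A) A dphiP; have [d3 d4] := derive_oo (- A) A FP.
rewrite (Rintegration_by_parts AA _ d1 d2 _ d3 d4); try exact: continuous_subspaceT.
have [-> _] : phi A = 0 /\ dphi A = 0 by apply: supp; rewrite ger0_norm// ltW.
have [-> _] : phi (- A) = 0 /\ dphi (- A) = 0 by apply: supp; rewrite normrN ger0_norm// ltW.
by rewrite !mul0r subrr sub0r.
Qed.

Let intble_patchR (f : R -> R) x y : intble mu f ->
  intble mu (f \_ `[x, y]) /\ \Rint[mu]_t (f \_ `[x, y]) t = Rintegral mu `[x, y] f.
Proof.
move=> i; split; last by rewrite unlock [RHS]Rintegral_mkcond.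
apply: (@le_intbleR _ _ (fun t => `|f t|)); last exact: intble_norm.
- apply/(measurable_restrictT _ _).1 => //; apply: measurable_funTS; exact: intble_measurable i.
- by move=> t; rewrite patchE; case: ifPn => // _; rewrite normr0.
Qed.

(** The distributional derivative of [sgn (x - y)] is twice the Dirac mass at [y]: the fundamental
    theorem of calculus is applied on each side of [y]. *)
Lemma Rint_dphi_sg y : \Rint[mu]_x (dphi x * Num.sg (x - y)) = - 2 * phi y.
Proof.
have B0 := normr_ge0 y; have ny := ler_norm y; have nny := ler_norm (- y); rewrite normrN in nny.
(* Large enough for [[-B, B]] to contain [y] in its interior and [phi] to vanish at both ends. *)
pose B := A + `|y| + 1.
have yB : y < B by rewrite /B; have := A0; lra.
have By : - B < y by rewrite /B; have := A0; lra.
have Bn : A <= `|B| by rewrite ger0_norm /B; have := A0; lra.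
have Bn' : A <= `|- B| by rewrite normrN.
have [i1 e1] := @intble_patchR dphi y B idphi.
have [i2 e2] := @intble_patchR dphi (- B) y idphi.
rewrite (@eq_Rint _ _ _ mu _ (fun x => (dphi \_ `[y, B]) x - (dphi \_ `[- B, y]) x)); last first.
  move=> x; rewrite !patchE !mem_setE !in_itv/=.
  have [xA|Ax] := leP A `|x|.
    by rewrite (supp xA).2 mul0r; do 2 case: ifPn => _ //=; rewrite subrr.
  have xB : x <= B by have := ler_norm x; rewrite /B; lra.
  have Bx : - B <= x by have := ler_norm (- x); rewrite normrN /B; lra.
  rewrite xB Bx/= andbT; have [xy|yx|->] := ltgtP x y.
  - by rewrite ltr0_sg ?subr_lt0// mulrN1 sub0r.
  - by rewrite gtr0_sg ?subr_gt0// mulr1 subr0.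
  - by rewrite subrr sgr0 mulr0 subrr.
rewrite RintB// e1 e2 /Rintegral.
have [d1 d2] := derive_oo y B dphiP; have [d3 d4] := derive_oo (- B) y dphiP.
rewrite (continuous_FTC2 yB _ d1 d2); last exact: continuous_subspaceT.
rewrite (continuous_FTC2 By _ d3 d4); last exact: continuous_subspaceT.
by rewrite (supp Bn).1 (supp Bn').1/=; ring.
Qed.

Let w (y x : R) : R := `|x - y| `^ a.

Let measurable_w y : measurable_fun setT (w y).
Proof. by rewrite /w; meas; exact: measurable_cst. Qed.

Let w_bound y x : `|w y x| <= (1 + `|y| `^ a) * (1 + `|x| `^ a).
Proof.
rewrite ger0_norm ?powR_ge0// /w.
have : `|x - y| `^ a <= `|x| `^ a + `|y| `^ a.
  by rewrite -(normrN y) abs_powR_subadditive.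
have := powR_ge0 `|x| a; have := powR_ge0 `|y| a; nra.
Qed.

Let is_derive_spow2 y h (x : R) : is_derive x 1 (fun x => spow2 a (x - y) h)
  (2 * w y x - w y (x + h) - w y (x - h)).
Proof.
have D k : is_derive x 1 (spow a \o (id + cst k : R -> R)) (`|x + k| `^ a).
  have d1 : is_derive x 1 (id + cst k : R -> R) 1 by apply: is_derive_eq; rewrite addr0.
  have := @is_derive1_comp _ (spow a) (id + cst k) x _ _ (is_derive_spow a01 (x + k)) d1.
  by rewrite mulr1.
have -> : (fun x => spow2 a (x - y) h) = 2 \*: (spow a \o (id + cst (- y) : R -> R)) -
    (spow a \o (id + cst (- y + h) : R -> R)) - (spow a \o (id + cst (- y - h) : R -> R)).
  by apply/funext => u; rewrite /spow2 !fctE /= !addrA.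
have := D (- y); have := D (- y + h); have := D (- y - h) => D1 D2 D3.
apply: is_derive_eq; rewrite /w /GRing.scale/=.
by rewrite !addrA (addrAC x h) (addrAC x (- h)).
Qed.

Let Rint_phi_w y h :
  \Rint[mu]_x (phi x * (2 * w y x - w y (x + h) - w y (x - h))) =
  - \Rint[mu]_x (dphi x * spow2 a (x - y) h).
Proof.
apply: (@Rint_by_parts (fun x => spow2 a (x - y) h)
  (fun x => 2 * w y x - w y (x + h) - w y (x - h))).
- by move=> x; exact: is_derive_spow2.
- have cw k : continuous (fun x : R => `|x + k| `^ a).
    move=> x; apply: (@continuous_comp R R R (fun x => x + k) (fun x => `|x| `^ a)).
      by apply: cvgD; [exact: cvg_id|exact: cvg_cst].
    exact: (abs_powR_continuous a01).
  have -> : (fun x => 2 * w y x - w y (x + h) - w y (x - h)) =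
      (fun x => 2 * `|x + - y| `^ a - `|x + (- y + h)| `^ a - `|x + (- y - h)| `^ a).
    by apply/funext => x; rewrite /w !addrA (addrAC x h) (addrAC x (- h)).
  move=> x.
  apply: cvgB; first apply: cvgB.
  + by apply: cvgM; [exact: cvg_cst|exact: cw].
  + exact: cw.
  + exact: cw.
Qed.

Lemma measurable_spow2_2 y : measurable_fun setT (fun z : R * R => spow2 a (z.1 - y) z.2).
Proof.
have m := measurable_spow a; rewrite /spow2.
apply: measurable_funB; first apply: measurable_funB; first apply: measurable_funM => //.
all: by apply: (measurableT_comp m); meas.
Qed.

Lemma Rint_kernel_flap y : intble mu (fun x => `|x - y| `^ a * flap a phi x) /\
  \Rint[mu]_x (`|x - y| `^ a * flap a phi x) = 2 * riesz_cst a * phi y.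
Proof.
have c0 : 0 <= 1 + `|y| `^ a by rewrite addr_ge0// powR_ge0.
have [i E] := Rint_mul_flap a01 A0 dphiP supp lip (measurable_w y) c0 (w_bound y).
split => //; rewrite E.
rewrite (eq_Rint mu (fun h => congr1 (fun t => hker a h * t) (Rint_phi_w y h))).
pose F x h := dphi x * (hker a h * spow2 a (x - y) h).
have mF : measurable_fun setT (fun z : R * R => F z.1 z.2).
  apply: measurable_funM; first exact: (measurableT_comp mdphi measurable_fst).
  apply: measurable_funM; last exact: measurable_spow2_2.
  exact: (measurableT_comp (measurable_hker a) measurable_snd).
(* A second exchange brings the [h]-integral inside, where [hker_spow2] evaluates it to a multiple
   of [sgn (x - y)]. *)
have [|||i1 i2 E2] := @Fubini_R _ F (fun x => `|dphi x| * - riesz_cst a) mF.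
- by move=> x; apply: intbleZl; have [] := hker_spow2 a01 (x - y).
- by apply: intbleZr; exact: intble_norm.
- move=> x; have [j _] := hker_spow2 a01 (x - y).
  rewrite (@eq_Rint _ _ _ mu _ (fun h => `|dphi x| * `|hker a h * spow2 a (x - y) h|)).
    rewrite RintZl; last exact: intble_norm.
    by rewrite ler_wpM2l// hker_spow2_norm.
  by move=> h; rewrite normrM.
have E3 h : \Rint[mu]_x F x h = hker a h * \Rint[mu]_x (dphi x * spow2 a (x - y) h).
  rewrite -RintZl; first by apply: eq_Rint => x; rewrite /F; ring.
  apply: (intble_compact_support A0) => [x|x xA]; last by rewrite (supp xA).2 mul0r.
  by apply: cvgM; [exact: cdphi|exact: (derive_cont (is_derive_spow2 y h))].
have E4 x : \Rint[mu]_h F x h = riesz_cst a * (dphi x * Num.sg (x - y)).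
  have [j e] := hker_spow2 a01 (x - y).
  by rewrite RintZl// e; ring.
have isg : intble mu (fun x => dphi x * Num.sg (x - y)).
  have rc : riesz_cst a != 0 by rewrite lt_eqF// riesz_cst_lt0.
  apply: (@eq_intble _ _ _ mu (fun x => (riesz_cst a)^-1 * \Rint[mu]_h F x h)).
    by move=> x; rewrite E4 mulKf.
  exact: intbleZl.
have := E2; rewrite (eq_Rint mu E4) RintZl// Rint_dphi_sg (eq_Rint mu E3) => H.
rewrite (@eq_Rint _ _ _ mu _ (fun h => - (hker a h * \Rint[mu]_x (dphi x * spow2 a (x - y) h)))); last first.
  by move=> h; rewrite mulrN.
rewrite RintN -?H; first by ring.
by apply: (@eq_intble _ _ _ mu _ _ E3).
Qed.

(** The weight 1 has vanishing second differences; this is what removes the constant [K] in the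
    final computation. *)
Lemma Rint_flap : intble mu (flap a phi) /\ \Rint[mu]_x flap a phi x = 0.
Proof.
have mc : measurable_fun setT (fun _ : R => 1 : R) by exact: measurable_cst.
have [|i E] := Rint_mul_flap a01 A0 dphiP supp lip mc ler01.
  by move=> x; rewrite normr1 mul1r lerDl powR_ge0.
split; first by apply: (@eq_intble _ _ _ mu _ _ _ i) => x; rewrite mul1r.
rewrite (@eq_Rint _ _ _ mu _ (fun x => 1 * flap a phi x)); last by move=> x; rewrite mul1r.
rewrite E (@eq_Rint _ _ _ mu _ (fun=> 0)); first by rewrite RintE integral0.
move=> h; rewrite (@eq_Rint _ _ _ mu _ (fun=> 0)); first by rewrite RintE integral0 mulr0.
by move=> x; ring.
Qed.

End fundamental_solution.

(** * The solution *)

Section constant.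
Context (R : realType).
Notation mu := (@lebesgue_measure R).

(** A divergent integral would have the default value 0, so integrability has to be shown first. The
    range (0, 2] contains the arguments [1/2 + s] and [1 - s] met below. *)
Lemma euler_gamma_gt0 (x : R) : 0 < x <= 2 -> 0 < euler_gamma x.
Proof.
move=> /andP[x0 x2]; rewrite /euler_gamma Rintegral_mkcond.
set g := _ \_ _.
have gE t : g t = if 0 < t then t `^ (x - 1) * expR (- t) else 0.
  by rewrite /g patchE; case: ifPn => [/set_mem/= ->//|]; rewrite notin_setE/= => /negP/negbTE ->.
have mg : measurable_fun setT g.
  rewrite (_ : g = fun t => if 0 < t then t `^ (x - 1) * expR (- t) else 0); last exact/funext.
  apply: measurable_fun_ifT => //; first exact: measurable_fun_ltr.
  by meas.
have ig : intble mu g.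
  (* Beyond 1, [t^(x - 1) <= t] and [e^(- t) <= 6 t^-3], where 6 is 3!. *)
  apply: (@intble_le_powR R (1 - x) 2 6) => //.
  - by rewrite ltrBlDr ltrDl.
  - by rewrite ltr1n.
  - by move=> t t0; rewrite gE ltNge t0.
  - move=> t t0 t1; rewrite gE t0 ger0_norm ?mulr_ge0 ?powR_ge0 ?expR_ge0// opprB mulrC.
    by rewrite ler_wpM2r ?powR_ge0// (@le_trans _ _ 1) ?expR_le1 ?oppr_le0 ?(ltW t0)// ler1n.
  - move=> t t1; have t0 := lt_trans ltr01 t1.
    rewrite gE t0 ger0_norm ?mulr_ge0 ?powR_ge0 ?expR_ge0//.
    apply: (@le_trans _ _ (t * (6 * t ^- 3))).
      apply: ler_pM; rewrite ?powR_ge0 ?expR_ge0//.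
        rewrite -[leRHS](powRr1 (ltW t0)) ler_powR ?(ltW t1)//; lra.
      rewrite expRN -[6]invrK -invfM lef_pV2 ?posrE ?expR_gt0 ?mulr_gt0 ?exprn_gt0 ?invr_gt0//.
      have := @expR_ge1Dxn _ t 2 (ltW t0); rewrite (_ : 3`!%:R = 6 :> R)//.
      rewrite mulrC; lra.
    rewrite powRN powR_mulrn ?(ltW t0)// mulrCA ler_pM2l//.
    rewrite exprS invfM mulrA divff ?mul1r// gt_eqF//.
have := @Rint_gt0 _ g 0 1 ltr01 ig; rewrite unlock; apply.
- by move=> t; rewrite gE; case: ifPn => // _; rewrite mulr_ge0 ?powR_ge0 ?expR_ge0.
- by move=> t t0 _; rewrite gE t0 mulr_gt0 ?powR_gt0 ?expR_gt0.
Qed.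

Lemma frac_laplacian_cst_gt0 (s : R) : 2^-1 < s < 1 -> 0 < frac_laplacian_cst s.
Proof.
move=> /andP[s1 s2]; have s0 : 0 < s by lra.
have h0 : 0 < 2^-1 + s by lra.
rewrite /frac_laplacian_cst mulr_gt0//.
  by rewrite divr_gt0 ?powR_gt0// sqrtr_gt0 pi_gt0.
apply: divr_gt0.
  rewrite /Gamma h0 big_ord0 divr1 addr0; apply: euler_gamma_gt0.
  by apply/andP; split; lra.
rewrite normr_gt0 /Gamma ifF; last by apply/negbTE; rewrite -leNgt oppr_le0 ltW.
(* For [0 < s < 1] one recursion step suffices: [Gamma (- s)] is [euler_gamma (1 - s) / (- s)]. *)
rewrite opprK (_ : Num.truncn s = 0%N); last first.
  by apply/truncn0Pn; rewrite -ltNge.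
rewrite big_ord1 addr0 mulf_neq0//.
  rewrite gt_eqF// euler_gamma_gt0//; apply/andP; split; lra.
by rewrite invr_eq0 oppr_eq0 gt_eqF.
Qed.

End constant.

Section solution.
Context (R : realType).
Notation mu := (@lebesgue_measure R).
Variable s : R.
Hypothesis s01 : 2^-1 < s < 1.

Let a := 2 * s - 1.
Let a01 : 0 < a < 1.
Proof. by case/andP: s01 => h1 h2; rewrite /a; apply/andP; split; lra. Qed.
Let a0 : 0 < a. Proof. by case/andP: a01. Qed.

(** Growth [|x|^a] against the weight of order [|x|^-(2 + a)] leaves [|x|^-2]. *)
Lemma L_space_asymptotic (v : R -> R) (lam B : R) : 0 <= lam -> measurable_fun setT v ->
  (forall x, `|v x + lam * `|x| `^ a| <= B) -> L_space s v.
Proof.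
move=> lam0 mv vB.
have B0 : 0 <= B by exact: (le_trans (normr_ge0 _) (vB 0)).
have v_le x : `|v x| <= B + lam * `|x| `^ a.
  have := vB x; have : 0 <= lam * `|x| `^ a by rewrite mulr_ge0 ?powR_ge0.
  by rewrite !ler_norml => ? /andP[? ?]; apply/andP; split; lra.
split.
  split => //; first exact: openT.
  move=> K _ cK; have [N [_ HN]] := compact_bounded cK.
  have {}HN x : K x -> `|x| <= N + 1 by apply: HN; rewrite ltrDl.
  have mK : measurable K by exact: compact_measurable.
  apply: (@le_lt_trans _ _ (\int[mu]_(x in K) (B + lam * (N + 1) `^ a)%:E)%E).
    apply: ge0_le_integral => //.
    - by apply/measurable_EFinP; apply: measurable_funTS; exact: measurable_fun_norm.
    - move=> x Kx; rewrite lee_fin (le_trans (v_le x))// lerD2l ler_wpM2l//.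
      apply: ge0_ler_powR; rewrite ?nnegrE ?(ltW a0)//; last exact: HN.
      exact: (le_trans (normr_ge0 _) (HN x Kx)).
  rewrite integral_cst//; apply: lte_mul_pinfty => //; last exact: compact_finite_measure.
  by rewrite lee_fin addr_ge0// mulr_ge0// powR_ge0.
apply: intble_lty.
have E : 1 + 2 * s = 2 + a by rewrite /a; ring.
have d0 (x : R) : 0 < 1 + `|x| `^ (1 + 2 * s) by rewrite ltr_wpDr ?powR_ge0.
apply: (@intble_le_abs_powR R 2 (B + lam)).
- by rewrite ltr1n.
- rewrite (_ : (fun x => _) = (fun x => `|v x| * (1 + `|x| `^ (1 + 2 * s)) `^ (-1))).
    by apply: measurable_funM; meas; exact: measurable_cst.
  by apply/funext => x; rewrite powR_inv1// ltW.
- move=> x x1; rewrite ger0_norm ?divr_ge0// ?(ltW (d0 x))// ler_pdivrMr//.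
  apply: le_trans (v_le x) _.
  apply: (@le_trans _ _ ((B + lam) * 1)).
    rewrite mulr1 lerD2l ler_piMr//.
    have : `|x| `^ a <= 1 `^ a by apply: ge0_ler_powR; rewrite ?nnegrE ?(ltW a0).
    by rewrite powR1.
  by rewrite ler_wpM2l ?addr_ge0// lerDl powR_ge0.
- move=> x x1; have x0 := lt_trans ltr01 x1.
  rewrite ger0_norm ?divr_ge0// ?(ltW (d0 x))// ler_pdivrMr//.
  apply: le_trans (v_le x) _; rewrite -mulrA.
  have e : `|x| `^ (- 2) * `|x| `^ (1 + 2 * s) = `|x| `^ a.
    by rewrite E -powRD ?(gt_eqF x0) ?implybT//; congr (_ `^ _); ring.
  have xa : 1 <= `|x| `^ a by rewrite -(powRr0 `|x|) ler_powR ?(ltW a0) ?(ltW x1).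
  apply: (@le_trans _ _ ((B + lam) * `|x| `^ a)).
    by rewrite mulrDl lerD2r ler_peMr.
  by rewrite ler_wpM2l ?addr_ge0// mulrDr mulr1 e lerDr powR_ge0.
Qed.

End solution.

Theorem theorem1p2 (R : realType) (s : R) (hs1 : 2^-1 < s) (hs2 : s < 1) :
  exists u : R -> R,
    liouville_solution s u /\
    (\int[@lebesgue_measure R]_(x in [set: R]) (expR (u x))%:E < +oo)%E.
Proof.
have s01 : 2^-1 < s < 1 by rewrite hs1 hs2.
set a := 2 * s - 1.
have a01 : 0 < a < 1 by rewrite /a; apply/andP; split; lra.
have a01' : 0 < a <= 1 by case/andP: a01 => -> /ltW.
set C := frac_laplacian_cst s.
have C0 : 0 < C := frac_laplacian_cst_gt0 s01.
have rc0 := riesz_cst_lt0 a01; set rc := riesz_cst a in rc0.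
(* Chosen so that [- lam * C * (2 * rc) = 1], the coefficient of [e^v] after the final exchange; it
   is positive because [rc] is negative. *)
pose lam := (- (2 * C * rc))^-1.
have lam0 : 0 < lam by rewrite invr_gt0 oppr_gt0 pmulr_rlt0// mulr_gt0.
have [v [K [B [mv vB dv vE]]]] := mean_field_solution a01 lam0.
have [me e0 ie e1 em] := dv.
exists v; split; last exact: (intble_lty ie).
split.
- exact: L_space_asymptotic (ltW lam0) mv vB.
- by apply: open_integrable_locally; [exact: openT|exact: intbleP ie].
move=> phi /test_function_props[dphi [A [M [A0 dphiP supp lip]]]].
pose L := flap a phi.
have [iL L0] := Rint_flap a01 A0 dphiP supp lip; rewrite -/L in iL L0.
have fund y := Rint_kernel_flap a01 A0 dphiP supp lip y.
have mL : measurable_fun setT L := intble_measurable iL.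
pose rho := expR \o v.
pose F x y := `|x - y| `^ a * rho y * L x.
have mF : measurable_fun setT (fun z : R * R => F z.1 z.2).
  apply: measurable_funM; last exact: (measurableT_comp mL measurable_fst).
  apply: measurable_funM; first by meas.
  exact: (measurableT_comp me measurable_snd).
pose m := \Rint[@lebesgue_measure R]_y (`|y| `^ a * rho y).
have [|||i1 i2 E] := @Fubini_R _ F (fun x => (`|x| `^ a + m) * `|L x|) mF.
- by move=> x; apply: intbleZr; exact: intble_riesz.
(* Integrability of the bound is the kernel lemma at [y = 0] for the first term, and integrability
   of [L] for the second. *)
- apply: (@eq_intble _ _ _ (@lebesgue_measure R) (fun x => `| (`|x - 0| `^ a * L x) | + m * `|L x|)).
    by move=> x; rewrite subr0 normrM (ger0_norm (powR_ge0 _ _)) mulrDl.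
  by apply: intbleD; [apply: intble_norm; exact: (fund 0).1|exact/intbleZl/intble_norm].
- move=> x; rewrite (@eq_Rint _ _ _ (@lebesgue_measure R) _ (fun y => `|x - y| `^ a * rho y * `|L x|)).
    rewrite RintZr; last exact: intble_riesz.
    by rewrite ler_wpM2r// riesz_le.
  by move=> y; rewrite /F normrM ger0_norm// mulr_ge0 ?powR_ge0// expR_ge0.
have E1 x : \Rint[@lebesgue_measure R]_y F x y = riesz a rho x * L x.
  by rewrite RintZr//; exact: intble_riesz.
have E2 y : \Rint[@lebesgue_measure R]_x F x y = 2 * rc * (rho y * phi y).
  rewrite (@eq_Rint _ _ _ (@lebesgue_measure R) _ (fun x => rho y * (`|x - y| `^ a * L x))).
    by rewrite RintZl ?(fund y).2; [rewrite -/rc; ring|exact: (fund y).1].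
  by move=> x; rewrite /F; ring.
have irho : intble (@lebesgue_measure R) (fun y => rho y * phi y).
  have rc1 : 2 * rc != 0 by rewrite mulf_neq0// ?pnatr_eq0// lt_eqF.
  apply: (@eq_intble _ _ _ (@lebesgue_measure R) (fun y => (2 * rc)^-1 * \Rint[@lebesgue_measure R]_x F x y)).
    by move=> y; rewrite E2 mulKf.
  exact: intbleZl.
have iR : intble (@lebesgue_measure R) (fun x => riesz a rho x * L x).
  exact: (@eq_intble _ _ _ (@lebesgue_measure R) _ _ E1).
have vLE x : v x * frac_laplacian s phi x =
    (- (lam * C)) * (riesz a rho x * L x) - (K * C) * L x.
  rewrite (@frac_laplacianE _ _ s01 _ _ _ _ A0 dphiP supp lip) -/a -/L -/C {1}vE -/rho.
  ring.
have iv1 := intbleZl (- (lam * C)) iR; have iv2 := intbleZl (K * C) iL.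
rewrite (_ : (fun x => (v x * frac_laplacian s phi x)%:E) =
  (fun x => ((- (lam * C)) * (riesz a rho x * L x) - (K * C) * L x)%:E)); last first.
  by apply/funext => x; rewrite vLE.
rewrite intbleE; last exact: intbleB.
rewrite intbleE//; congr EFin.
(* The constant [K] drops out because [L] has integral zero. *)
rewrite RintB// !RintZl// L0 mulr0 subr0.
have -> : \Rint[@lebesgue_measure R]_x (riesz a rho x * L x) =
    2 * rc * \Rint[@lebesgue_measure R]_y (rho y * phi y).
  by rewrite -(eq_Rint (@lebesgue_measure R) E1) E (eq_Rint (@lebesgue_measure R) E2) RintZl.
rewrite mulrA (_ : - (lam * C) * (2 * rc) = 1) ?mul1r//.
by rewrite /lam; field; rewrite (lt_eqF rc0) (gt_eqF C0).

Qed.
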